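(* Let $\mathcal{H}$ be a real Hilbert space and let $f:\mathcal{H}\to\mathbb{R}\cup\{+\infty\}$ be proper, convex, lower semicontinuous with $\operatorname{argmin} f\neq\emptyset$; let $x^*$ be the element of minimal norm of $\operatorname{argmin} f$. Let $\alpha,c>0$, $0<q<1$, $1<p<q+1$, and for $k\ge1$ put $\alpha_k=1-\frac{\alpha}{k^q}$, $c_k=\frac{c}{k^p}$. Let $x_0,x_1\in\mathcal H$ and let $(x_k)$ be generated by $$x_{k+1}=\operatorname{prox}_{f}\big(x_k+\alpha_k(x_k-x_{k-1})-c_kx_k\big),\quad k\ge1.$$ For every $k\ge 2$ let $u_k\in\partial f(x_k)$ be the element satisfying $$x_k=\alpha_{k-1}(x_{k-1}-x_{k-2})-u_k+(1-c_{k-1})x_{k-1}.$$ For $k\ge1$ let $f_k(x)=f(x)+\frac{c}{2k^p}\|x\|^2$ and let $\overline{x}_k$ be the unique minimizer of $f_k$ over $\mathcal H$. Then the following hold. (i) If $p\le 2q$, then $\|x_n-\overline{x}_n\|=\mathcal{O}(n^{\frac{q-1}{2}})$ as $n\to+\infty$, hence $\lim_{n\to+\infty}x_n=x^*$ (strongly). Further, $\|x_n-x_{n-1}\|^2=\mathcal{O}(n^{q-p-1})$, $\|u_n\|^2=\mathcal{O}(n^{q-p-1})$ and $f(x_n)-\min_{\mathcal H} f=\mathcal{O}(n^{-p})$ as $n\to+\infty$. (ii) If $2q<p\le\frac{3q+1}{2}$, then $\|x_n-\overline{x}_n\|=\mathcal{O}(n^{\frac{q-1}{2}})$ as $n\to+\infty$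 and $\lim_{n\to+\infty}x_n=x^*$ (strongly). Further, $f_n(x_n)-f_n(\overline{x}_n)$, $\|x_n-x_{n-1}\|^2$ and $\|u_n\|^2$ are all $\mathcal{O}(n^{-q-1})$, and $f(x_n)-\min_{\mathcal H} f=\mathcal{O}(n^{-p})$ as $n\to+\infty$. Moreover, $\sum_{k=2}^{+\infty}k^q(f_k(x_k)-f_k(\overline{x}_k))<+\infty$, $\sum_{k=2}^{+\infty}k^{2q}\|u_k\|^2<+\infty$ and $\sum_{k=1}^{+\infty}k^q\|x_{k+1}-x_k\|^2<+\infty$. (iii) If $\frac{3q+1}{2}<p<q+1$, then $\|x_n-\overline{x}_n\|=\mathcal{O}(n^{p-q-1})$ as $n\to+\infty$, hence $\lim_{n\to+\infty}x_n=x^*$ (strongly). Further, $f_n(x_n)-f_n(\overline{x}_n)$, $\|x_n-x_{n-1}\|^2$ and $\|u_n\|^2$ are all $\mathcal{O}(n^{2p-4q-2})$ as $n\to+\infty$. Additionally, if $\frac{3q+1}{2}<p<\frac{4q+2}{3}$, then $f(x_n)-\min_{\mathcal H} f=\mathcal{O}(n^{-p})$, and if $\frac{4q+2}{3}\le p<q+1$, then $f(x_n)-\min_{\mathcal H} f=\mathcal{O}(n^{2p-4q-2})$ as $n\to+\infty$. Moreover, $\sum_{k=2}^{+\infty}k^q(f_k(x_k)-f_k(\overline{x}_k))<+\infty$, $\sum_{k=2}^{+\infty}k^{2q}\|u_k\|^2<+\infty$ and $\sum_{k=1}^{+\infty}k^q\|x_{k+1}-x_k\|^2<+\infty$.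
   Context: For $s>0$, $\operatorname{prox}_{sf}(x)=\operatorname{argmin}_{y\in\mathcal H}\left(f(y)+\frac{1}{2s}\|y-x\|^2\right)$. $\partial f$ is the convex subdifferential; since $\operatorname{prox}_{f}=(I+\partial f)^{-1}$, the vector $u_k$ defined by the stated equality indeed belongs to $\partial f(x_k)$. The minimal norm element of $\operatorname{argmin} f$ is the projection of $0$ onto this nonempty closed convex set. *)

(* Defs.v *)
From HB Require Import structures.
From mathcomp Require Import all_boot all_order all_algebra.
From mathcomp Require Import all_classical all_reals all_analysis.

Set Implicit Arguments.
Unset Strict Implicit.
Unset Printing Implicit Defensive.

Import Order.TTheory GRing.Theory Num.Theory numFieldNormedType.Exports.

Local Open Scope classical_set_scope.
Local Open Scope ring_scope.

Definition argmin (T : Type) (R : realType) (g : T -> \bar R) : set T :=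
  [set x | forall y, (g x <= g y)%E].

Definition is_min_norm (R : realType) (H : normedModType R) (A : set H) (x : H)
    : Prop :=
  A x /\ forall y, A y -> `|x| <= `|y|.

(* Functions H -> R U {+oo} are functions into \bar R omitting -oo. *)
Definition eproper (T : Type) (R : realType) (f : T -> \bar R) : Prop :=
  (forall x, f x != -oo%E) /\ exists x, (f x < +oo)%E.

(* The library's [convex_function] only covers real-valued functions.  At the
   endpoints t = 0, 1 the convention 0 * +oo = 0 makes the inequality trivial. *)
Definition econvex (R : realType) (H : lmodType R) (f : H -> \bar R) : Prop :=
  forall (x y : H) (t : R), 0 <= t <= 1 ->
    (f ((t *: x + (1 - t) *: y)%R) <= t%:E * f x + (1 - t)%:E * f y)%E.

(* Since f is proper, no vector satisfies this when f x = +oo. *)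
Definition subdiff (R : realType) (H : lmodType R) (dot : H -> H -> R)
    (f : H -> \bar R) (x : H) : set H :=
  [set u | forall y, (f x + (dot u (y - x)%R)%:E <= f y)%E].

(* The minimizer exists and is unique for s > 0 and f proper, convex and lower
   semicontinuous on a Hilbert space; 0 is a dummy value otherwise. *)
Definition prox (R : realType) (H : normedModType R) (s : R)
    (f : H -> \bar R) (x : H) : H :=
  xget 0 (argmin (fun y => f y + ((2 * s)^-1 * `|y - x| ^+ 2)%:E)%E).

Definition tikhonov (R : realType) (H : normedModType R) (f : H -> \bar R)
    (c p : R) (k : nat) (x : H) : \bar R :=
  (f x + (c / (2 * k%:R `^ p) * `|x| ^+ 2)%:E)%E.

(* Landau's O for extended-real sequences: [fine], which sends +oo to 0, would
   make the corresponding real-valued statements hold vacuously at +oo. *)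
Definition ebigO (R : realType) (g : nat -> \bar R) (h : nat -> R) : Prop :=
  exists C : R, \forall n \near \oo, (`|g n| <= (C * `|h n|)%:E)%E.

(* Main.v *)
(* Write y_k = x_k - xbar_k, v_k = x_k - x_{k-1}, G_k = f_k(x_k) - f_k(xbar_k), h = k^(-q).
   The energy
     W_k = G_k + (1 - alpha h / 2) |v_k|^2 / 2 + beta h <y_k, v_k>
           + alpha beta h^2 |y_{k-1}|^2 / 2,
   with beta small, is bounded below by a multiple of G_k + |v_k|^2 + h^2 |y_k|^2 up to
   O(k^(-2q-2)), and the subgradient inequalities at x_{k+1} together with the c_k-strong convexity
   of f_k give, with g_{k+1} = u_{k+1} + c_k x_k and delta > 0,
     W_{k+1} + delta (h G_{k+1} + h |v_{k+1}|^2 + h c_k |y_{k+1}|^2 + |g_{k+1}|^2)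
       <= W_k + O(k^(-p-1) + k^(p-3q-2)),
   because |xbar_{k+1} - xbar_k| = O(1/k).  The dissipation dominates a multiple of
   k^(-rho) W_{k+1} with rho = max(q, p - q) < 1, so a discrete Gronwall lemma yields
   W_k = O(k^(rho - min(p+1, 3q+2-p))), which specializes to the three regimes.  Multiplying the
   inequality by k^(2q) and telescoping gives the summability claims when 2q < p.

   Strong convexity also gives |x^* - xbar_k|^2 <= |x^*|^2 - |xbar_k|^2 and, for k <= l,
   |xbar_l - xbar_k|^2 <= |xbar_l|^2 - |xbar_k|^2: the path is Cauchy, by lower semicontinuity its
   limit minimizes f, and minimality of |x^*| identifies the limit without weak compactness. *)
Require Import Defs.
From HB Require Import structures.
From mathcomp Require Import all_boot all_order all_algebra ring lra.
From mathcomp Require Import all_classical all_reals all_analysis.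

Set Implicit Arguments.
Unset Strict Implicit.
Unset Printing Implicit Defensive.

Import Order.TTheory GRing.Theory Num.Theory numFieldNormedType.Exports.

Local Open Scope classical_set_scope.
Local Open Scope ring_scope.

(** * Inner-product estimates and the one-step energy inequality *)

Lemma ler_pM_le1 {R : realDomainType} (t x z : R) :
  0 <= t <= 1 -> 0 <= z -> x <= z -> t * x <= z.
Proof.
move=> /andP[t0 t1] z0 xz; apply: le_trans (ler_wpM2l t0 xz) _.
exact: ler_piMl.
Qed.

Section RealInnerProduct.
Context {R : realType} {H : completeNormedModType R} (dot : {dot H for idfun}).
Hypothesis norm_dot : forall v : H, `|v| = Num.sqrt (dot v v).
Implicit Types x y z : H.

Lemma dotC x y : dot x y = dot y x.
Proof. by rewrite (hermC dot) /= expr0 mul1r. Qed.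

Lemma dotDl x y z : dot (x + y) z = dot x z + dot y z.
Proof. exact: linearDl. Qed.

Lemma dotDr x y z : dot z (x + y) = dot z x + dot z y.
Proof. exact: linearDr. Qed.

Lemma dotNl x z : dot (- x) z = - dot x z.
Proof. exact: linearNl. Qed.

Lemma dotNr x z : dot z (- x) = - dot z x.
Proof. exact: linearNr. Qed.

Lemma dotZl t x z : dot (t *: x) z = t * dot x z.
Proof. exact: linearZl_LR. Qed.

Lemma dotZr t x z : dot z (t *: x) = t * dot z x.
Proof. by rewrite dotC dotZl dotC. Qed.

Definition dotE := (dotDl, dotDr, dotNl, dotNr, dotZl, dotZr).

Lemma dot_ge0 x : 0 <= dot x x.
Proof.
have [->|x0] := eqVneq x 0; first by rewrite (linear0r dot).
exact/ltW/neq0_dnorm_gt0.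
Qed.

Lemma normr_dot x : `|x| ^+ 2 = dot x x.
Proof. by rewrite norm_dot sqr_sqrtr ?dot_ge0. Qed.

Lemma dot_young t x y : 0 < t -> 2 * dot x y <= t * dot x x + dot y y / t.
Proof.
move=> t0.
have e : t * (t * dot x x + dot y y / t - 2 * dot x y) =
  dot (t *: x - y) (t *: x - y) by rewrite !dotE (dotC y x); field; lra.
by rewrite -subr_ge0 -(pmulr_rge0 _ t0) e dot_ge0.
Qed.

Lemma dot_sum3_le x y z :
  dot (x + y + z) (x + y + z) <= 3 * (dot x x + dot y y + dot z z).
Proof.
have := dot_ge0 (x - y); have := dot_ge0 (x - z); have := dot_ge0 (y - z).
rewrite !dotE (dotC y x) (dotC z x) (dotC z y); lra.
Qed.

(* h plays the role of k^(-q) and yprev that of the previous error.  Using yprev instead of y makes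
   the term - a beta h^2 <y, v> produced by the friction telescope; the factor 1 - a h / 2 leaves
   dissipation in both the old and the new velocity. *)
Definition energy (a beta h G : R) (y v yprev : H) : R :=
  G + (1 - a / 2 * h) / 2 * dot v v + beta * h * dot y v
  + a * beta * h ^+ 2 / 2 * dot yprev yprev.

(** The last two hypotheses come from testing the subgradient at the new iterate against the old
    iterate and against the path; they are added with weights 1 and [beta * h]. Here [w] and [w']
    are the current and previous path increments, so [y + v' - w] is the next error and [y - v + w']
    the previous one; [e] pays for the decrease of the Tikhonov coefficient, and [kappa] bounds the
    relative decrease of [h]. *)
Lemma energy_step (a beta h h' s e kappa G G' : R) (y v v' w w' g : H) :
  0 < beta -> beta <= a / 32 -> 0 < h' -> h' <= h -> h <= 2 * h' ->
  a * h <= 1 -> beta * h <= 1 / 2 -> 0 < s -> s <= a / 32 * h ->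
  h - h' <= kappa * h -> 16 * kappa ^+ 2 <= s -> 0 <= e ->
  v' = (1 - a * h) *: v - g ->
  G' + (1 - s) / 2 * dot v' v' + dot g g / 2
    <= G + (1 - a * h) ^+ 2 / 2 * dot v v + e ->
  G' + s / 2 * dot (y + v' - w) (y + v' - w) - s * dot (y + v' - w) v' - e
    <= dot (y + v' - w) g ->
  energy a beta h' G' (y + v' - w) v' y + dot g g / 2 + beta * h * G'
    + beta * h * s / 8 * dot (y + v' - w) (y + v' - w) + a / 32 * h * dot v' v'
  <= energy a beta h G y v (y - v + w') + 2 * e
     + 2 * beta * h * (dot w w + dot w' w')
     + 4 * beta * h * (a * h) ^+ 2 / s * dot w' w'.
Proof.
move=> b0 ba h'0 h'h hh' ah1 bh s0 sh hk ks e0 vE H1 H2.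
have a0 : 0 < a by rewrite -(pmulr_lgt0 _ (_ : 0 < 32^-1)) // (lt_le_trans b0).
have hh0 : 0 <= h - h' by rewrite subr_ge0.
have h0 : 0 < h by exact: lt_le_trans h'h.
have bh0 : 0 < beta * h by rewrite mulr_gt0.
have ah0 : 0 < a * h by rewrite mulr_gt0.
rewrite /energy.
set y' := y + v' - w in H1 H2 *.
have y'g : dot y' v' = (1 - a * h) * (dot y v + dot v' v - dot w v) - dot y' g.
  by rewrite {1}vE dotDr dotNr dotZr {1}/y' !dotE.
have prevE : dot (y - v + w') (y - v + w') = dot y y - 2 * dot y v +
    2 * dot y w' + dot (v - w') (v - w').
  rewrite !dotE (dotC v y) (dotC w' y) (dotC w' v); ring.
have yw' : dot y w' = dot y' w' - dot v' w' + dot w w'.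
  by rewrite /y' !dotE; ring.
have s8 : 0 < s / 8 by rewrite divr_gt0.
have Y0 := dot_young y' v' (divr_gt0 ltr01 (ltr0Sn R 1)).
have Y1 := dot_young v' v ltr01.
have Y2 := dot_young (- w) v ltr01.
have Y3 := dot_young v' w' ltr01.
have Y4 := dot_young (- w) w' ltr01.
have Y5 := dot_young y' (- kappa *: v') s8.
have Y6 := dot_young y' (- (a * h) *: w') s8.
rewrite !(dotNl, dotNr) in Y2 Y4.
rewrite !(dotZl, dotZr) in Y5 Y6.
have A0 := dot_ge0 v; have A'0 := dot_ge0 v'; have P0 := dot_ge0 y'.
have W0 := dot_ge0 w; have W'0 := dot_ge0 w'; have YY0 := dot_ge0 y.
have D0 := dot_ge0 (v - w').
(* Every inner product becomes an independent real, leaving a scalar inequality with the Young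
   bounds as data. *)
move: (dot (v - w') (v - w')) (dot y' v') (dot y v) (dot y w') (dot v v) (dot v' v')
  (dot y' y') (dot w w) (dot w' w') (dot y y) (dot g g) (dot (y - v + w') (y - v + w'))
  (dot v' v) (dot w v) (dot y' g) (dot y' w') (dot v' w') (dot w w')
  H1 H2 y'g prevE yw' Y0 Y1 Y2 Y3 Y4 Y5 Y6 A0 A'0 P0 W0 W'0 YY0 D0
  => D Y'V' YV YW' A A' P W W' YY GG Yp V'V WV Y'G Y'W' V'W' WW'.
clear y v v' w w' g vE y' => H1 H2 y'g prevE yw' Y0 Y1 Y2 Y3 Y4 Y5 Y6.
move=> A0 A'0 P0 W0 W'0 YY0 D0.
(* Young with weight [s / 8]: the error part fits in the strong-convexity term, and
   [16 * kappa ^+ 2 <= s] caps the velocity part. *)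
have {}Y5 : kappa * - Y'V' <= s / 16 * P + A' / 4.
  have h6 : kappa ^+ 2 * (A' / (s / 8)) <= A' / 2.
    rewrite (_ : _ * _ = 16 * kappa ^+ 2 * (A' / (2 * s))); last by field; exact: lt0r_neq0.
    apply: le_trans (ler_wpM2r _ ks) _; first by rewrite divr_ge0 ?mulr_ge0 // ltW.
    by rewrite le_eqVlt; apply/orP; left; apply/eqP; field; exact: lt0r_neq0.
  have e6 : - kappa * (- kappa * A') / (s / 8) = kappa ^+ 2 * (A' / (s / 8)) by ring.
  by rewrite e6 in Y5; clear -h6 Y5; lra.
have {}Y6 : (a * h) * - Y'W' <= s / 16 * P + 4 * (a * h) ^+ 2 / s * W'.
  have e6 : - (a * h) * (- (a * h) * W') / (s / 8) = 2 * (4 * (a * h) ^+ 2 / s * W').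
    by field; exact: lt0r_neq0.
  by rewrite e6 in Y6; clear -Y6; lra.
have {}Y0 : Y'V' <= P / 4 + A' by clear -Y0; lra.
have ah01 : 0 <= a * h <= 1 by rewrite ltW.
have ah01' : 0 <= 1 - a * h <= 1 by clear -ah0 ah1; apply/andP; split; lra.
(* The recurrence replaces <y', g> by (1 - a h) <y, v> - <y', v'> up to products with increments,
   which is what makes the cross term of the energy telescope. *)
have S1 : Y'V' <= (1 - a * h) * YV + (A' / 2 + A + W / 2)
    - G' - s / 4 * P + s * A' + e.
  have : (1 - a * h) * (V'V - WV) <= A' / 2 + A + W / 2.
    by apply: ler_pM_le1 => //; [rewrite !addr_ge0 ?divr_ge0|clear -Y1 Y2; lra].
  have : s * Y'V' <= s * (P / 4 + A') by rewrite ler_wpM2l // ltW.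
  by clear -H2 y'g; lra.
(* The new energy carries [h'] where [S1] is multiplied by [h]; this is the cost of the exchange. *)
have S2 : - (h - h') * Y'V' <= h * (s / 16 * P + A' / 4).
  have [xy|xy] := lerP 0 (Y'V').
    apply: (@le_trans _ _ 0); first by rewrite mulNr oppr_le0 mulr_ge0.
    by rewrite mulr_ge0 ?addr_ge0 ?mulr_ge0 ?invr_ge0 // ltW.
  have : (h - h') * - Y'V' <= kappa * h * - Y'V' by rewrite ler_wpM2r // oppr_ge0 ltW.
  by have := ler_wpM2l (ltW h0) Y5; clear; lra.
have S3 : a * h * - YW' <= s / 16 * P + 4 * (a * h) ^+ 2 / s * W'
   + A' / 2 + W / 2 + W'.
  have : a * h * (V'W' - WW') <= A' / 2 + W / 2 + W'.
    by apply: ler_pM_le1 => //; [rewrite !addr_ge0 ?divr_ge0|clear -Y3 Y4 W0 W'0; lra].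
  by rewrite yw'; clear -Y6; lra.
have S4 : (1 - a * h) ^+ 2 * A <= (1 - a * h) * A.
  by case/andP: ah01' => *; rewrite ler_wpM2r // expr2 ler_piMl.
have S5 : a * h * A' <= 2 * (a * h') * A'.
  by rewrite ler_wpM2r // mulrCA ler_wpM2l // ltW.
have S6 : a * beta * h' ^+ 2 * YY <= a * beta * h ^+ 2 * YY.
  by rewrite ler_wpM2r // ler_wpM2l ?ler_pXn2r ?nnegrE ?mulr_ge0 // ltW.
have S7 : 0 <= beta * h * (a * h) * D.
  by rewrite !mulr_ge0 // ltW.
have B1 := ler_wpM2l (ltW bh0) S1.
have B2 := ler_wpM2l (ltW b0) S2.
have B3 := ler_wpM2l (ltW bh0) S3.
have B4 : beta * h * (s * A') <= 1 / 2 * (s * A').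
  by rewrite ler_wpM2r ?mulr_ge0 // ltW.
have B5 : s * A' <= a / 32 * h * A' by rewrite ler_wpM2r.
have B6 : beta * (h * A') <= a / 32 * (h * A').
  by rewrite ler_wpM2r ?mulr_ge0 // ltW.
have B7 : beta * (h * A) <= a / 32 * (h * A).
  by rewrite ler_wpM2r ?mulr_ge0 // ltW.
have B8 : beta * h * e <= 1 / 2 * e by rewrite ler_wpM2r.
have B9 : 0 <= a * (h * A) by rewrite !mulr_ge0 // ltW.
have B10 : 0 <= a * (h * A') by rewrite !mulr_ge0 // ltW.
have B11 : 0 <= beta * h * W by rewrite !mulr_ge0 // ltW.
have B12 : 0 <= beta * h * W' by rewrite !mulr_ge0 // ltW.
rewrite prevE.
clear -H1 B1 B2 B3 B4 B5 B6 B7 B8 B9 B10 B11 B12 S4 S5 S6 S7 e0.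
lra.
Qed.

(** The energy contains the square of the previous error, so the cross term is rewritten as <y, v> =
    <yp, v> + |v|^2 - <w, v>. Young with weight a h / 2 then spends half of the |yp|^2 term, and
    [beta <= a / 32] keeps the velocity part small. *)
Lemma energy_ge (a beta h G : R) (y v w : H) :
  0 < beta -> beta <= a / 32 -> 0 < h -> a * h <= 1 ->
  G + dot v v / 8 + a * beta * h ^+ 2 / 4 * dot (y - v + w) (y - v + w)
  <= energy a beta h G y v (y - v + w) + 4 * (beta * h) ^+ 2 * dot w w.
Proof.
move=> b0 ba h0 ah1.
have a0 : 0 < a by rewrite -(pmulr_lgt0 _ (_ : 0 < 32^-1)) // (lt_le_trans b0).
rewrite /energy; set yp := y - v + w.
have yvE : dot y v = dot yp v + dot v v - dot w v by rewrite /yp !dotE; ring.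
have Y1 := dot_young (- yp) v (divr_gt0 (mulr_gt0 a0 h0) (ltr0Sn R 1)).
have Y2 := dot_young (beta * h *: w) v (ltr0Sn R 7).
rewrite !(dotNl, dotNr, dotZl, dotZr) in Y1 Y2.
have V0 := dot_ge0 v.
rewrite yvE; move: (dot yp v) (dot yp yp) (dot v v) (dot w v) (dot w w) V0 Y1 Y2.
move=> YV P A WV W; clear y v w yp yvE => A0 Y1 Y2.
have B1 := ler_wpM2l (ltW (mulr_gt0 b0 h0)) Y1.
have B2 : beta * h * (A / (a * h / 2)) <= A / 16.
  rewrite (_ : _ * _ = beta * (2 * A / a)); last by field; rewrite !lt0r_neq0.
  apply: le_trans (ler_wpM2r _ ba) _; first by rewrite divr_ge0 ?mulr_ge0 // ltW.
  by rewrite le_eqVlt; apply/orP; left; apply/eqP; field; rewrite !lt0r_neq0.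
have B3 : a * h * A <= A by rewrite ler_piMl.
have B4 : 0 <= beta * h * A by rewrite !mulr_ge0 // ltW.
by clear -Y2 B1 B2 B3 B4 A0; lra.
Qed.

(** Lets the dissipation absorb a multiple of the energy; the error is expressed at the current
    index because the dissipation is available there. *)
Lemma energy_le (a beta h G : R) (y v w : H) :
  0 < beta -> beta <= a / 32 -> 0 < h -> a * h <= 1 -> beta * h <= 1 / 2 ->
  energy a beta h G y v (y - v + w)
  <= G + 2 * dot v v + 2 * a * beta * h ^+ 2 * (dot y y + dot w w).
Proof.
move=> b0 ba h0 ah1 bh.
have a0 : 0 < a by rewrite -(pmulr_lgt0 _ (_ : 0 < 32^-1)) // (lt_le_trans b0).
rewrite /energy; have S := dot_sum3_le y (- v) w.
have Y := dot_young v (beta * h *: y) ltr01.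
have A0 := dot_ge0 v; have P0 := dot_ge0 y; have W0 := dot_ge0 w.
rewrite !(dotNl, dotNr, opprK) in S; rewrite !(dotZl, dotZr) (dotC v y) in Y.
move: (dot y v) (dot (y - v + w) (y - v + w)) (dot v v) (dot y y) (dot w w) S Y A0 P0 W0.
move=> YV Q A P W; clear y v w => S Y A0 P0 W0.
have ah0 : 0 < a * h by exact: mulr_gt0.
have abh0 : 0 <= a * beta * h ^+ 2 by rewrite !mulr_ge0 // ltW.
have B1 := ler_wpM2l abh0 S.
have B2 : a * beta * h ^+ 2 * A <= 1 / 2 * A.
  rewrite ler_wpM2r // (_ : _ * _ = (a * h) * (beta * h)); last by ring.
  by apply: le_trans bh; rewrite ler_piMl // mulr_ge0 // ltW.
have B3 : (beta * h) ^+ 2 * P <= a * beta * h ^+ 2 * P.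
  rewrite ler_wpM2r // exprMn ler_wpM2r ?sqr_ge0 // expr2 ler_wpM2r ?(ltW b0) //.
  by apply: le_trans ba _; rewrite ler_pdivrMr // ler_peMr ?(ltW a0) // ler1n.
have B4 : 0 <= a * h * A by rewrite mulr_ge0 // ltW.
have B5 : 0 <= a * beta * h ^+ 2 * W by rewrite mulr_ge0.
by clear -Y B1 B2 B3 B4 B5 A0; lra.
Qed.

End RealInnerProduct.

(** * Powers of natural numbers *)

Section NatPowers.
Context {R : realType}.
Implicit Types (r s x y : R) (n : nat).

(** This is exp t >= 1 + t at t = r ln (x / y), valid for exponents of either sign. Together with ln
    t <= t - 1 it gives the bounds below on differences of consecutive powers. *)
Lemma powR_tangent x y r : 0 < x -> 0 < y -> y `^ r * (1 + r * ln (x / y)) <= x `^ r.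
Proof.
move=> x0 y0; rewrite {2}(_ : x = y * (x / y)); last by rewrite mulrCA divff ?mulr1 ?lt0r_neq0.
rewrite powRM ?divr_ge0 ?(ltW x0) ?(ltW y0) //; apply: ler_wpM2l; first exact: powR_ge0.
by rewrite /powR gt_eqF ?divr_gt0 // expR_ge1Dx.
Qed.

Lemma ln_le_subr1 x : 0 < x -> ln x <= x - 1.
Proof. by move=> x0; have := @le_ln1Dx _ (x - 1); rewrite (_ : 1 + _ = x); [apply; lra|ring]. Qed.

Lemma natr_powRD n r s : (0 < n)%N -> n%:R `^ (r + s) = n%:R `^ r * n%:R `^ s :> R.
Proof. by move=> n0; rewrite powRD // pnatr_eq0 -lt0n n0 implybT. Qed.

Lemma natr_powR_gt0 n r : (0 < n)%N -> 0 < n%:R `^ r :> R.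
Proof. by move=> n0; rewrite powR_gt0 ?ltr0n. Qed.

Lemma ler_natr_powR n r s : (0 < n)%N -> r <= s -> n%:R `^ r <= n%:R `^ s :> R.
Proof. by move=> n0 rs; rewrite ler_powR // ler1n. Qed.

Lemma natr_powR_le1 n r : (0 < n)%N -> r <= 0 -> n%:R `^ r <= 1 :> R.
Proof. by move=> n0 r0; rewrite -[leRHS](powRr0 n%:R); exact: ler_natr_powR. Qed.

Lemma natr_powRS_le n s : (0 < n)%N -> 0 <= s -> n.+1%:R `^ (- s) <= n%:R `^ (- s) :> R.
Proof.
move=> n0 s0; rewrite !powRN lef_pV2 ?posrE ?natr_powR_gt0 //.
by rewrite ge0_ler_powR ?nnegrE // ler_nat.
Qed.

Lemma natr_powR_le_double n s : (0 < n)%N -> 0 <= s ->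
  n%:R `^ (- s) <= 2 `^ s * n.+1%:R `^ (- s) :> R.
Proof.
move=> n0 s0; rewrite !powRN ler_pdivlMr ?natr_powR_gt0 // mulrC ler_pdivrMr ?natr_powR_gt0 //.
rewrite -powRM // ge0_ler_powR ?nnegrE ?mulr_ge0 //.
by rewrite -natrM ler_nat mul2n -addnn -addn1 leq_add2l.
Qed.

Lemma natr_powRS_le_double n r : 0 <= r -> (0 < n)%N ->
  n.+1%:R `^ r <= 2 `^ r * n%:R `^ r :> R.
Proof.
move=> r0 n0; rewrite -powRM // ge0_ler_powR ?nnegrE ?mulr_ge0 //.
by rewrite -natrM ler_nat mul2n -addnn -addn1 leq_add2l.
Qed.

Lemma natr_powR_sub_le n s : (0 < n)%N -> 0 <= s ->
  n%:R `^ (- s) - n.+1%:R `^ (- s) <= s * n%:R `^ (- s - 1) :> R.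
Proof.
move=> n0 s0; have n0' : 0 < n%:R :> R by rewrite ltr0n.
have := powR_tangent (- s) (ltr0Sn R n) n0'; rewrite natr_powRD // powR_inv1 ?ler0n //.
have : ln (n.+1%:R / n%:R) <= n%:R^-1 :> R.
  apply: le_trans (ln_le_subr1 _) _; rewrite ?divr_gt0 ?ltr0Sn //.
  by rewrite -natr1 mulrDl mul1r divff ?lt0r_neq0 // addrAC subrr add0r.
move=> /(ler_wpM2l s0)/(ler_wpM2l (powR_ge0 n%:R (- s))); lra.
Qed.

Lemma natr_powR_sub_ge n s : (0 < n)%N -> 0 <= s ->
  s * n.+1%:R `^ (- s - 1) <= n%:R `^ (- s) - n.+1%:R `^ (- s) :> R.
Proof.
move=> n0 s0; have n0' : 0 < n%:R :> R by rewrite ltr0n.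
have := powR_tangent (- s) n0' (ltr0Sn R n); rewrite natr_powRD // powR_inv1 ?ler0n //.
have : ln (n%:R / n.+1%:R) <= - n.+1%:R^-1 :> R.
  apply: le_trans (ln_le_subr1 _) _; rewrite ?divr_gt0 ?ltr0Sn //.
  rewrite (_ : n%:R / n.+1%:R = 1 - n.+1%:R^-1); first by rewrite addrAC subrr add0r.
  by rewrite -natr1; field; rewrite natr1 pnatr_eq0.
move=> /(ler_wpM2l s0)/(ler_wpM2l (powR_ge0 n.+1%:R (- s))); move: n.+1%:R => X; lra.
Qed.

Lemma natr_powRS_sub_le n r : (0 < n)%N -> 0 <= r ->
  n.+1%:R `^ r - n%:R `^ r <= r * 2 `^ r * n%:R `^ (r - 1) :> R.
Proof.
move=> n0 r0; have n0' : 0 < n%:R :> R by rewrite ltr0n.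
have := powR_tangent r n0' (ltr0Sn R n); rewrite natr_powRD // powR_inv1 ?ler0n //.
have : ln (n%:R / n.+1%:R) >= - n%:R^-1 :> R.
  rewrite -[n%:R / _]invf_div lnV ?posrE ?divr_gt0 // lerN2.
  apply: le_trans (ln_le_subr1 _) _; rewrite ?divr_gt0 ?ltr0Sn //.
  by rewrite -natr1 mulrDl mul1r divff ?lt0r_neq0 // addrAC subrr add0r.
move=> /(ler_wpM2l r0)/(ler_wpM2l (powR_ge0 n.+1%:R r)) h1 h2.
have := natr_powRS_le_double r0 n0.
have : 0 <= r * n%:R^-1 :> R by rewrite mulr_ge0 ?invr_ge0.
move=> rn /(ler_wpM2r rn); lra.
Qed.

Lemma near_natr_powR_le r (e : R) : r < 0 -> 0 < e ->
  \forall n \near \oo, n%:R `^ r <= e.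
Proof.
move=> r0 e0; near=> n.
have n0 : (0 < n)%N by near: n; exact: nbhs_infty_gt.
have : e `^ (r^-1) <= n%:R by near: n; exact: nbhs_infty_ger.
rewrite -[X in n%:R `^ X]opprK powRN -[X in _ -> _ <= X]invrK => h.
rewrite lef_pV2 ?posrE ?invr_gt0 ?natr_powR_gt0 //.
have /(ge0_ler_powR _ _ _) := h.
move=> /(_ (- r)); rewrite !nnegrE powR_ge0 ler0n oppr_ge0 (ltW r0) => /(_ isT isT isT).
by rewrite -powRrM mulrN mulVf ?lt_eqF // powR_inv1 // ltW.
Unshelve. all: by end_near. Qed.

End NatPowers.

(** * Discrete Gronwall and telescoping lemmas *)

Section DiscreteDecay.
Context {R : realType}.
Implicit Types (E a T : nat -> R).

Lemma near_succ (P : nat -> Prop) : (\forall k \near \oo, P k) -> \forall k \near \oo, P k.+1.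
Proof. by move=> [K _ KP]; exists K => // k /= Kk; apply: KP => /=; exact: leqW. Qed.

(** Induction on E_n <= M n^(-tau). Since [rho < 1], the relative loss tau / n from n^(-tau) to
    (n+1)^(-tau) eventually uses at most half of the contraction delta n^(-rho) / 2^tau, and the
    other half absorbs the source. *)
Lemma discrete_gronwall E (rho tau C delta : R) : rho < 1 -> 0 <= tau -> 0 < delta ->
  (\forall k \near \oo,
     E k.+1 + delta * (k%:R `^ (- rho) * E k.+1) <= E k + C * k%:R `^ (- (rho + tau))) ->
  exists2 M : R, 0 < M & \forall k \near \oo, E k <= M * k%:R `^ (- tau).
Proof.
move=> rho1 tau0 delta0 stepE.
have t20 : 0 < 2 `^ tau :> R by rewrite powR_gt0.
have tau1 : 0 < tau + 1 by lra.
have e0 : 0 < delta / 2 / (2 `^ tau * (tau + 1)) by rewrite !divr_gt0 // mulr_gt0.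
have rho10 : rho - 1 < 0 by lra.
have [K _ KP] : \forall k \near \oo, [/\ (0 < k)%N,
    E k.+1 + delta * (k%:R `^ (- rho) * E k.+1) <= E k + C * k%:R `^ (- (rho + tau)) &
    k%:R `^ (rho - 1) <= delta / 2 / (2 `^ tau * (tau + 1))].
  near=> k; split; [by near: k; exact: nbhs_infty_gt|by near: k|].
  by near: k; exact: near_natr_powR_le.
have [K0 _ _] := KP K (leqnn K).
have Kt0 : 0 < K%:R `^ (- tau) :> R by exact: natr_powR_gt0.
(* The first summand gives the base case at [K], the second makes the source at most half of the
   available contraction, and 1 keeps [M] positive. *)
pose M := `|E K| / K%:R `^ (- tau) + 2 * 2 `^ tau * `|C| / delta + 1.
have M1 : 0 <= `|E K| / K%:R `^ (- tau) by rewrite divr_ge0 // ltW.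
have M2 : 0 <= 2 * 2 `^ tau * `|C| / delta.
  by rewrite divr_ge0 ?mulr_ge0 // ltW.
have M0 : 0 < M by rewrite /M; lra.
exists M => //; exists K => // k /= /subnKC <-.
elim: (k - K)%N => [|j]; first rewrite addn0.
  apply: le_trans (ler_norm _) _; rewrite -ler_pdivrMr // /M; lra.
rewrite addnS; move: (K + j)%N (leq_addr j K) => n Kn IH.
have [n0 stepn smalln] := KP n Kn.
have r0 : 0 < n%:R `^ (- rho) :> R by exact: natr_powR_gt0.
have t0 : 0 < n%:R `^ (- tau) :> R by exact: natr_powR_gt0.
have t'0 : 0 < n.+1%:R `^ (- tau) :> R by exact: natr_powR_gt0.
have d1 := natr_powR_sub_le n0 tau0; have d2 := natr_powR_le_double n0 tau0.
have e1 : n%:R `^ (- tau - 1) = n%:R `^ (- rho) * n%:R `^ (- tau) * n%:R `^ (rho - 1) :> R.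
  by rewrite -!natr_powRD //; congr (_ `^ _); ring.
rewrite e1 in d1; rewrite opprD natr_powRD // in stepn.
have C0 : C <= delta * M / (2 * 2 `^ tau).
  apply: le_trans (ler_norm _) _; rewrite ler_pdivlMr ?mulr_gt0 // mulrC -ler_pdivrMl //.
  by rewrite mulrC /M; lra.
have d3 : tau * n%:R `^ (rho - 1) <= delta / (2 * 2 `^ tau).
  move: smalln; rewrite invfM mulrA ler_pdivlMr // => h.
  apply: (@le_trans _ _ (n%:R `^ (rho - 1) * (tau + 1))); last by rewrite invfM mulrA.
  by rewrite mulrC ler_wpM2l ?powR_ge0 //; lra.
rewrite -(ler_pM2r (_ : 0 < 1 + delta * n%:R `^ (- rho))); last first.
  by rewrite addr_gt0 // mulr_gt0.
have rt0 : 0 <= n%:R `^ (- rho) * n%:R `^ (- tau) :> R by rewrite mulr_ge0 // ltW.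
have f1 := ler_wpM2r rt0 C0.
have f2 := ler_wpM2l (ltW M0) d1.
have f3 := ler_wpM2l (ltW M0) (ler_wpM2l rt0 d3).
have d2' : n%:R `^ (- tau) / 2 `^ tau <= n.+1%:R `^ (- tau) :> R.
  by rewrite ler_pdivrMr // mulrC.
have f4 := ler_wpM2l (mulr_ge0 (ltW (mulr_gt0 M0 delta0)) (ltW r0)) d2'.
rewrite invfM in f1 f3; lra.
Unshelve. all: by end_near. Qed.

(** Discrete form of integrating t^(-b-1): convergent power sums are recorded as telescoping
    differences, ready to be added to a potential. *)
Lemma natr_powR_telescope (b : R) : 0 < b -> exists2 C : R, 0 < C &
  forall k, (0 < k)%N -> k%:R `^ (- b - 1) <= C * (k%:R `^ (- b) - k.+1%:R `^ (- b)).
Proof.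
move=> b0; exists (2 `^ (b + 1) / b); first by rewrite divr_gt0 // powR_gt0.
move=> k k0; have b1 : 0 <= b + 1 by lra.
have := natr_powR_le_double k0 b1; rewrite opprD => /le_trans; apply.
rewrite -mulrA ler_wpM2l ?powR_ge0 // ler_pdivlMl //.
by apply: natr_powR_sub_ge => //; exact: ltW.
Qed.

(** Summation by parts: the weight leaves the remainder ((k+1)^r - k^r) E_{k+1} = O(k^(r-1-tau)),
    which is summable because [r < tau]. *)
Lemma weighted_telescope E d src (r tau M : R) : 0 <= r -> r < tau ->
  (\forall k \near \oo, 0 <= E k <= M * k%:R `^ (- tau)) ->
  (\forall k \near \oo, E k.+1 + d k <= E k + src k) ->
  (exists2 b, 0 < b & exists C, \forall k \near \oo, k%:R `^ r * src k <= C * k%:R `^ (- b - 1)) ->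
  exists T, (\forall k \near \oo, 0 <= T k) /\
    \forall k \near \oo, k%:R `^ r * d k <= T k - T k.+1.
Proof.
move=> r0 rtau Ele stepE; have nE := near_succ Ele; move=> [b b0 [C srcle]].
have [C1 C10 tele1] := natr_powR_telescope b0.
have tr0 : 0 < tau - r by lra.
have [C2 C20 tele2] := natr_powR_telescope tr0.
have M0 : 0 <= `|M| by [].
pose D := r * 2 `^ r * `|M|.
have D0 : 0 <= D by rewrite !mulr_ge0 ?powR_ge0.
(* The weighted energy, plus one tail dominating the source and one dominating the
   summation-by-parts remainder. *)
exists (fun k => k%:R `^ r * E k + `|C| * C1 * k%:R `^ (- b) + D * C2 * k%:R `^ (- (tau - r))).
split.
  near=> k; have /andP[E0 _] : 0 <= E k <= M * k%:R `^ (- tau) by near: k.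
  by rewrite !addr_ge0 // !mulr_ge0 ?powR_ge0 // ltW.
near=> k.
have k0 : (0 < k)%N by near: k; exact: nbhs_infty_gt.
have /andP[E0 E1] : 0 <= E k.+1 <= M * k.+1%:R `^ (- tau) by near: k; exact: nE.
have st : E k.+1 + d k <= E k + src k by near: k.
have sr : k%:R `^ r * src k <= C * k%:R `^ (- b - 1) by near: k.
have b10 : 0 <= k%:R `^ (- b - 1) :> R by exact: powR_ge0.
have t1 := ler_wpM2l (normr_ge0 C) (tele1 k k0).
have t2 := ler_wpM2l D0 (tele2 k k0).
have t3 := ler_wpM2r b10 (ler_norm C).
have t4 := ler_wpM2l (powR_ge0 k%:R r) st.
have t5 : (k.+1%:R `^ r - k%:R `^ r) * E k.+1 <= D * k%:R `^ (- (tau - r) - 1).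
  have h1 := ler_wpM2r E0 (natr_powRS_sub_le k0 r0).
  apply: le_trans h1 _.
  have -> : D * k%:R `^ (- (tau - r) - 1) =
      r * 2 `^ r * k%:R `^ (r - 1) * (`|M| * k%:R `^ (- tau)).
    rewrite (_ : - (tau - r) - 1 = (r - 1) + - tau); last by ring.
    by rewrite natr_powRD // /D; ring.
  rewrite ler_wpM2l ?mulr_ge0 ?powR_ge0 //; apply: le_trans E1 _.
  apply: (@le_trans _ _ (`|M| * k.+1%:R `^ (- tau))).
    by rewrite ler_wpM2r ?powR_ge0 // ler_norm.
  by rewrite ler_wpM2l // natr_powRS_le //; lra.
lra.
Unshelve. all: by end_near. Qed.

(** A finite head plus a tail that telescopes to at most [T K]. The shift in [a k.+1] matches the
    energy estimates, which at step [k] control quantities of index [k.+1]. *)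
Lemma nneseries_telescope_lty m a T : (forall k, (m <= k)%N -> 0 <= a k) ->
  (\forall k \near \oo, 0 <= T k) -> (\forall k \near \oo, a k.+1 <= T k - T k.+1) ->
  (\sum_(m <= k <oo) (a k)%:E < +oo)%E.
Proof.
move=> a0 T0 aT.
have [K _ KP] : \forall k \near \oo, [/\ (m <= k)%N, 0 <= T k & a k.+1 <= T k - T k.+1].
  by near=> k; split; near: k => //; exact: nbhs_infty_ge.
have [mK _ _] := KP K (leqnn K).
have le_sum n : (K <= n)%N -> \sum_(K.+1 <= k < n.+1) a k <= T K - T n.
  move=> /subnKC <-; elim: (n - K)%N => [|j IH]; first by rewrite addn0 big_geq // subrr.
  rewrite addnS big_nat_recr /= ?ltnS ?leq_addr //.
  have [_ _] := KP (K + j)%N (leq_addr _ _); lra.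
apply: (@le_lt_trans _ _ (\sum_(m <= k < K.+1) a k + T K)%:E); last exact: ltry.
apply: lime_le; first by apply: is_cvg_nneseries => k mk _; rewrite lee_fin a0.
near=> n; have Kn : (K < n)%N by near: n; exact: nbhs_infty_gt.
rewrite sumEFin lee_fin (big_cat_nat _ (n := K.+1)) //=; last by rewrite (leq_trans mK).
have Kn' : (K <= n.-1)%N by rewrite -ltnS (ltn_predK Kn).
rewrite lerD2l -(ltn_predK Kn); apply: le_trans (le_sum _ Kn') _; rewrite gerBl.
by have [] := KP _ Kn'.
Unshelve. all: by end_near. Qed.

End DiscreteDecay.

(** * Energy decay along the inertial proximal sequence *)

Section InertialTikhonov.
Context {R : realType} {H : completeNormedModType R} (dot : {dot H for idfun}).
Variables (alpha c q p N B : R) (x z u : nat -> H) (F m : nat -> R).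
Hypotheses (alpha0 : 0 < alpha) (c0 : 0 < c) (q01 : 0 < q < 1) (p1 : 1 < p < q + 1).
Hypotheses (N0 : 0 <= N) (B0 : 0 <= B).

Let s k : R := c * k%:R `^ (- p).
Let h k : R := k%:R `^ (- q).
Let w k := z k.+1 - z k.

(* F k and m k stand for the finite values of f at x k and at the Tikhonov minimizer z k;
   only first-order inequalities between them are needed below. *)
Definition gap k := F k + s k / 2 * dot (x k) (x k) - (m k + s k / 2 * dot (z k) (z k)).
Definition err k := x k - z k.
Definition vel k := x k - x k.-1.
(** The Tikhonov term is explicit: the subgradient is taken at the new iterate, the regularization
    at the previous one with the previous coefficient. *)
Definition grad k := u k + s k.-1 *: x k.-1.

Hypothesis recE : forall k, (1 <= k)%N ->
  vel k.+1 = (1 - alpha * h k) *: vel k - grad k.+1.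
Hypothesis subgrad_prev : forall k, (2 <= k)%N -> F k.+1 + dot (u k.+1) (x k - x k.+1) <= F k.
Hypothesis subgrad_path : forall k, (2 <= k)%N -> F k + dot (u k) (z k - x k) <= m k.
Hypothesis path_min : forall k, (1 <= k)%N ->
  m k + s k / 2 * dot (z k) (z k) <= m k.+1 + s k / 2 * dot (z k.+1) (z k.+1).
Hypothesis path_bounded : forall k, (1 <= k)%N -> dot (z k) (z k) <= N.
Hypothesis path_slow : forall k, (1 <= k)%N -> dot (w k) (w k) <= B * k%:R `^ (-2).
Hypothesis gap_err : forall k, (2 <= k)%N -> s k / 2 * dot (err k) (err k) <= gap k.

Lemma s_gt0 k : (0 < k)%N -> 0 < s k.
Proof. by move=> k0; rewrite mulr_gt0 ?natr_powR_gt0. Qed.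

Lemma s_nonincr k : (0 < k)%N -> s k.+1 <= s k.
Proof.
move=> k0; rewrite ler_wpM2l ?(ltW c0) ?natr_powRS_le //.
by case/andP: p1 => *; apply: ltW; apply: lt_trans ltr01 _.
Qed.

Lemma gap_ge0 k : (2 <= k)%N -> 0 <= gap k.
Proof.
move=> k2; apply: le_trans (gap_err k2).
by rewrite mulr_ge0 ?dot_ge0 // divr_ge0 // ltW // s_gt0 // (leq_trans _ k2).
Qed.

(** Expanding |v' + g|^2 = (1 - alpha h)^2 |v|^2 brings out <g, v'>, which the subgradient
    inequality and polarization bound below by the increment of f_k. The explicit Tikhonov term
    costs s |v'|^2 / 2, and passing from f_k to f_{k+1} costs the last term. *)
Lemma gap_step k : (2 <= k)%N ->
  gap k.+1 + (1 - s k) / 2 * dot (vel k.+1) (vel k.+1) + dot (grad k.+1) (grad k.+1) / 2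
  <= gap k + (1 - alpha * h k) ^+ 2 / 2 * dot (vel k) (vel k) + (s k - s k.+1) / 2 * N.
Proof.
move=> k2; have k1 : (1 <= k)%N by exact: leq_trans k2.
have e1 : dot (vel k.+1) (vel k.+1) + 2 * dot (grad k.+1) (vel k.+1) +
    dot (grad k.+1) (grad k.+1) = (1 - alpha * h k) ^+ 2 * dot (vel k) (vel k).
  move: (recE k1); move: (vel k.+1) (grad k.+1) (vel k) => v' g v v'E.
  have -> : (1 - alpha * h k) ^+ 2 * dot v v = dot (v' + g) (v' + g).
    by rewrite v'E subrK !dotE; ring.
  by rewrite !dotE (dotC dot v' g); ring.
have e2 : dot (grad k.+1) (vel k.+1) = - dot (u k.+1) (x k - x k.+1) +
    s k / 2 * (dot (x k.+1) (x k.+1) - dot (x k) (x k) - dot (vel k.+1) (vel k.+1)).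
  rewrite /grad /vel /= !dotE (dotC dot (x k) (x k.+1)); lra.
have h1 := subgrad_prev k2; have h2 := path_min k1.
have D0 : 0 <= s k - s k.+1 by rewrite subr_ge0 s_nonincr.
have h3 := ler_wpM2l D0 (@path_bounded k.+1 isT).
have h4 := mulr_ge0 D0 (dot_ge0 dot (x k.+1)).
move: e1 e2 h1 h2 h3 h4; rewrite /gap.
move: (dot (vel k.+1) (vel k.+1)) (dot (grad k.+1) (grad k.+1))
  (dot (grad k.+1) (vel k.+1)) (dot (vel k) (vel k)) (dot (x k.+1) (x k.+1)) (dot (x k) (x k))
  (dot (z k.+1) (z k.+1)) (dot (z k) (z k)) (dot (u k.+1) (x k - x k.+1)).
by intros; lra.
Qed.

(** The subgradient at x_{k+1} is tested against z_{k+1}. Polarization of <y_{k+1}, x_{k+1}> yields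
    the squared error, and the lag x_k = x_{k+1} - v_{k+1} of the regularization yields the product
    with the velocity. *)
Lemma err_grad k : (2 <= k)%N ->
  gap k.+1 + s k / 2 * dot (err k.+1) (err k.+1) - s k * dot (err k.+1) (vel k.+1)
    - (s k - s k.+1) / 2 * N <= dot (err k.+1) (grad k.+1).
Proof.
move=> k2; have k1 : (1 <= k)%N by exact: leq_trans k2.
have e2 : dot (err k.+1) (grad k.+1) = - dot (u k.+1) (z k.+1 - x k.+1) +
    s k / 2 * (dot (err k.+1) (err k.+1) + dot (x k.+1) (x k.+1) - dot (z k.+1) (z k.+1))
    - s k * dot (err k.+1) (vel k.+1).
  rewrite /grad /vel /err /= !dotE (dotC dot (z k.+1) (x k.+1)).
  rewrite (dotC dot (z k.+1) (u k.+1)) (dotC dot (x k.+1) (u k.+1)); lra.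
have h1 := @subgrad_path k.+1 (leqW k2).
have D0 : 0 <= s k - s k.+1 by rewrite subr_ge0 s_nonincr.
have h3 := ler_wpM2l D0 (@path_bounded k.+1 isT).
have h4 := mulr_ge0 D0 (dot_ge0 dot (x k.+1)).
move: e2 h1 h3 h4; rewrite /gap.
move: (dot (err k.+1) (grad k.+1)) (dot (err k.+1) (vel k.+1)) (dot (err k.+1) (err k.+1))
  (dot (x k.+1) (x k.+1)) (dot (z k.+1) (z k.+1)) (dot (u k.+1) (z k.+1 - x k.+1)).
by intros; lra.
Qed.

(** The bound [alpha / 32] keeps the energy coercive; [1 / 2] gives [beta * h k <= 1 / 2], as
    [h k <= 1]. *)
Let beta := Num.min (alpha / 32) (1 / 2).

Lemma beta_gt0 : 0 < beta.
Proof. by rewrite lt_min !divr_gt0. Qed.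

Lemma beta_le : beta <= alpha / 32.
Proof. by rewrite ge_min lexx. Qed.

Lemma betah_le k : (0 < k)%N -> beta * h k <= 1 / 2.
Proof.
move=> k0; apply: (@le_trans _ _ beta); last by rewrite ge_min lexx orbT.
rewrite ler_piMr ?(ltW beta_gt0) // natr_powR_le1 // oppr_le0.
by case/andP: q01 => /ltW.
Qed.

Definition energy_seq k := energy dot alpha beta (h k) (gap k) (err k) (vel k) (err k.-1).

Lemma err_succ k : err k.+1 = err k + vel k.+1 - w k.
Proof.
by rewrite /err /vel /w /= opprB [x k - z k + _]addrC !subrKA.
Qed.

Lemma err_pred k : (0 < k)%N -> err k.-1 = err k - vel k + w k.-1.
Proof.
by case: k => // k _ /=; rewrite err_succ [_ - w _ - vel _]addrAC addrK subrK.
Qed.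

Lemma near_energy_step : \forall k \near \oo,
  energy_seq k.+1 + dot (grad k.+1) (grad k.+1) / 2 + beta * h k * gap k.+1
    + beta * h k * s k / 8 * dot (err k.+1) (err k.+1)
    + alpha / 32 * h k * dot (vel k.+1) (vel k.+1)
  <= energy_seq k + (s k - s k.+1) * N
     + 2 * beta * h k * (dot (w k) (w k) + dot (w k.-1) (w k.-1))
     + 4 * beta * h k * (alpha * h k) ^+ 2 / s k * dot (w k.-1) (w k.-1).
Proof.
have [/andP[q0 q1] /andP[p0 pq]] := (q01, p1).
(* These three negative exponents give, for large k, 16 (q / k)^2 <= s_k, s_k <= alpha h_k / 32 and
   alpha h_k <= 1, with q / k in the role of [kappa]. *)
have np2 : p - 2 < 0 by lra.
have nqp : q - p < 0 by lra.
have nq : - q < 0 by lra.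
have ai : 0 < alpha^-1 by rewrite invr_gt0.
have aci : 0 < alpha / 32 / c by rewrite !divr_gt0.
have cqi : 0 < c / (16 * q ^+ 2) by rewrite !divr_gt0 ?mulr_gt0 // exprn_gt0.
near=> k.
have k2 : (2 <= k)%N by near: k; exact: nbhs_infty_ge.
have k0 : (0 < k)%N by exact: leq_trans k2.
have kr0 : 0 < k%:R :> R by rewrite ltr0n.
have ah1 : alpha * h k <= 1.
  rewrite mulrC -ler_pdivlMr // div1r.
  by near: k; exact: near_natr_powR_le.
have sh : s k <= alpha / 32 * h k.
  have : k%:R `^ (q - p) <= alpha / 32 / c by near: k; exact: near_natr_powR_le.
  rewrite ler_pdivlMr // natr_powRD // -(ler_pM2r (natr_powR_gt0 (- q) k0)) => sh; apply: le_trans sh.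
  rewrite /s le_eqVlt; apply/orP; left; apply/eqP.
  rewrite (powRN _ q); field; exact/lt0r_neq0/natr_powR_gt0.
have kap : 16 * (q / k%:R) ^+ 2 <= s k.
  have : k%:R `^ (p - 2) <= c / (16 * q ^+ 2) by near: k; exact: near_natr_powR_le.
  rewrite /s powRB ?pnatr_eq0 -?lt0n ?k0 ?implybT // powR_mulrn ?ler0n // powRN.
  rewrite ler_pdivlMr ?mulr_gt0 ?exprn_gt0 // => k3.
  rewrite ler_pdivlMr ?natr_powR_gt0 //; apply: le_trans k3.
  rewrite le_eqVlt; apply/orP; left; apply/eqP; field; exact: lt0r_neq0.
have h'h : h k.+1 <= h k by rewrite natr_powRS_le // ltW.
have hh' : h k <= 2 * h k.+1.
  apply: le_trans (natr_powR_le_double k0 (ltW q0)) _; rewrite ler_wpM2r ?powR_ge0 //.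
  by rewrite -[leRHS](@powRr1 R 2) // ler_powR ?ler1n // ltW.
have hk : h k - h k.+1 <= q / k%:R * h k.
  apply: le_trans (natr_powR_sub_le k0 (ltW q0)) _.
  rewrite natr_powRD // powR_inv1 // /h; lra.
have D0 : 0 <= (s k - s k.+1) / 2 * N by rewrite mulr_ge0 // divr_ge0 // subr_ge0 s_nonincr.
have := @energy_step R H dot alpha beta (h k) (h k.+1) (s k) ((s k - s k.+1) / 2 * N)
  (q / k%:R) (gap k) (gap k.+1) (err k) (vel k) (vel k.+1) (w k) (w k.-1) (grad k.+1).
rewrite -err_succ -err_pred //.
move=> /(_ beta_gt0 beta_le (natr_powR_gt0 (- q) (ltn0Sn k)) h'h hh' ah1 (betah_le k0) (s_gt0 k0) sh hk kap D0
  (recE k0) (gap_step k2) (err_grad k2)).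
rewrite (_ : 2 * ((s k - s k.+1) / 2 * N) = (s k - s k.+1) * N) //.
by field.
Unshelve. all: by end_near. Qed.

(* k^(-p-1) comes from the variation of the Tikhonov coefficient, k^(p-3q-2) from the motion of
   the path; the error terms of order k^(-q-2) are dominated by the former since p < q + 1. *)
Let src k : R := k%:R `^ (- p - 1) + k%:R `^ (p - 3 * q - 2).

Lemma path_slow_pred k : (2 <= k)%N -> dot (w k.-1) (w k.-1) <= 4 * B * k%:R `^ (-2).
Proof.
case: k => [//|k]; rewrite ltnS => k0 /=; apply: le_trans (path_slow k0) _.
have := @natr_powR_le_double R k 2 k0 (ler0n _ _).
by move=> /(ler_wpM2l B0) /le_trans; apply; rewrite powR_mulrn // le_eqVlt; apply/orP; left; apply/eqP; ring.
Qed.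

Lemma hw_le_src k : (0 < k)%N -> h k * k%:R `^ (-2) <= src k.
Proof.
move=> k0; rewrite -natr_powRD // ler_wpDr ?powR_ge0 // ler_natr_powR //.
by case/andP: p1; lra.
Qed.

Lemma s_sub_le k : (0 < k)%N -> s k - s k.+1 <= c * p * src k.
Proof.
move=> k0; have p0 : 0 <= p by case/andP: p1; lra.
rewrite -mulrBr -mulrA ler_wpM2l ?(ltW c0) //; apply: le_trans (natr_powR_sub_le k0 p0) _.
by rewrite ler_wpM2l // lerDl powR_ge0.
Qed.

Lemma h3w_le_src k : (0 < k)%N ->
  h k * h k ^+ 2 / s k * k%:R `^ (-2) <= c^-1 * src k.
Proof.
move=> k0; have -> : h k * h k ^+ 2 / s k * k%:R `^ (-2) = c^-1 * k%:R `^ (p - 3 * q - 2).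
  have -> : p - 3 * q - 2 = p + (- q + (- q + (- q + (-2)))) by ring.
  rewrite !natr_powRD // /s /h (powRN _ p); field.
  by rewrite !lt0r_neq0 ?natr_powR_gt0.
by rewrite ler_wpM2l ?invr_ge0 ?(ltW c0) // lerDr powR_ge0.
Qed.

(* The last term compensates the negative part in energy_ge. *)
Definition lyap k := energy_seq k + 32 * beta ^+ 2 * B * (h k ^+ 2 * k%:R `^ (-2)).

Lemma near_ah_le1 : \forall k \near \oo, alpha * h k <= 1.
Proof.
have ai : 0 < alpha^-1 by rewrite invr_gt0.
have nq : - q < 0 by case/andP: q01; lra.
near=> k; rewrite mulrC -ler_pdivlMr // div1r.
by near: k; exact: near_natr_powR_le.
Unshelve. all: by end_near. Qed.

Lemma near_lyap_ge : exists2 C : R, 0 < C & \forall k \near \oo,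
  [/\ gap k <= lyap k, dot (vel k) (vel k) <= C * lyap k &
      h k ^+ 2 * dot (err k) (err k) <= C * lyap k].
Proof.
have b0 := beta_gt0.
have ab0 : 0 < alpha * beta by exact: mulr_gt0.
(* Three times the constants for the previous error, the velocity and the path increment, whose
   combination is the current error. *)
exists (12 / (alpha * beta) + 24 + 3 / (4 * beta ^+ 2)).
  by rewrite !addr_gt0 ?divr_gt0 ?mulr_gt0 // exprn_gt0.
near=> k.
have k2 : (2 <= k)%N by near: k; exact: nbhs_infty_ge.
have k0 : (0 < k)%N by exact: leq_trans k2.
have ah1 : alpha * h k <= 1 by near: k; exact: near_ah_le1.
have h0 : 0 < h k by exact: natr_powR_gt0.
have h1 : h k <= 1 by rewrite natr_powR_le1 // oppr_le0; case/andP: q01 => /ltW.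
have := @energy_ge R H dot alpha beta (h k) (gap k) (err k) (vel k) (w k.-1) b0 beta_le h0 ah1.
have S := @dot_sum3_le R H dot (err k.-1) (vel k) (- w k.-1).
rewrite -err_pred // in S *.
have errE : err k.-1 + vel k - w k.-1 = err k by rewrite err_pred // addrAC addrK subrK.
rewrite errE !(dotNl, dotNr, opprK) in S.
have W1 := path_slow_pred k2; have G0 := gap_ge0 k2.
have := dot_ge0 dot (vel k); have := dot_ge0 dot (err k.-1); have := dot_ge0 dot (w k.-1).
rewrite -/(energy_seq k) /lyap.
move: S W1 G0 ah1 h0 h1 ab0 b0.
move: (energy_seq k) (gap k) (dot (err k.-1) _) (dot (vel k) _) (dot (w k.-1) _) (dot (err k) _).
move: (h k) (k%:R `^ (-2)) => hk t E G P A W Y S W1 G0 ah1 h0 h1 ab0 b0 W0 P0 A0 L.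
have bh0 : 0 < 4 * (beta * hk) ^+ 2 by rewrite mulr_gt0 // exprn_gt0 // mulr_gt0.
set E' := E + _.
have W2 := ler_wpM2l (ltW bh0) W1.
(* The compensating term is at least twice the negative part in [energy_ge], so one copy survives to
   bound the path increment. *)
have L' : G + A / 8 + alpha * beta * hk ^+ 2 / 4 * P + 4 * (beta * hk) ^+ 2 * W <= E'.
  by rewrite /E'; lra.
have bhW : 0 <= 4 * (beta * hk) ^+ 2 * W by rewrite mulr_ge0 // ltW.
have hP0 : 0 <= alpha * beta * hk ^+ 2 / 4 * P.
  by rewrite mulr_ge0 // divr_ge0 // mulr_ge0 ?sqr_ge0 // ltW.
have E0 : 0 <= E' by lra.
have AE : A <= 8 * E' by lra.
have C1 : 0 <= 12 / (alpha * beta) * E' by rewrite mulr_ge0 // divr_ge0 // ltW.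
have C2 : 0 <= 3 / (4 * beta ^+ 2) * E' by rewrite mulr_ge0 // divr_ge0 // mulr_ge0 // sqr_ge0.
split; [lra|lra|].
have P1 : hk ^+ 2 * P <= 4 / (alpha * beta) * E'.
  by rewrite [leRHS]mulrAC ler_pdivlMr //; lra.
have W3 : hk ^+ 2 * W <= (4 * beta ^+ 2)^-1 * E'.
  rewrite [leRHS]mulrC ler_pdivlMr ?mulr_gt0 ?exprn_gt0 //; lra.
have A1 : hk ^+ 2 * A <= 8 * E'.
  by apply: le_trans AE; rewrite ler_piMl // expr_le1 // ltW.
have := ler_wpM2l (sqr_ge0 hk) S; lra.
Unshelve. all: by end_near. Qed.

(** With [q <= rho], the damping h dominates k^(-rho) on the gap and the velocity; with
    [p - q <= rho], k^(-rho) h^2 <= h s / c, so the strong-convexity dissipation dominates the error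
    part of the energy. *)
Lemma near_lyap_step (rho : R) : q <= rho -> p - q <= rho ->
  exists C delta : R, [/\ 0 < C, 0 < delta & \forall k \near \oo,
    lyap k.+1 + delta * (k%:R `^ (- rho) * lyap k.+1 + h k * gap k.+1
      + h k * dot (vel k.+1) (vel k.+1) + dot (grad k.+1) (grad k.+1))
    <= lyap k + C * src k].
Proof.
move=> qrho prho.
have [/andP[q0 q1] /andP[p0 pq]] := (q01, p1).
have b0 := beta_gt0.
(* One bound per dissipative term, in order: gap, gradient, velocity, error. *)
have [delta d0 [d1 d2 d3 d4]] : exists2 delta : R, 0 < delta &
    [/\ delta <= beta / 2, delta <= 1 / 2, delta <= alpha / 128 & delta <= c / (32 * alpha)].
  exists (Num.min (Num.min (beta / 2) (1 / 2)) (Num.min (alpha / 128) (c / (32 * alpha)))).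
    by rewrite !lt_min !divr_gt0 ?mulr_gt0.
  by rewrite !ge_min !lexx !orbT.
pose L := 32 * beta ^+ 2 * B.
have L0 : 0 <= L by rewrite !mulr_ge0 // ltW.
(* In order: variation of the Tikhonov coefficient; path increments, with 5 B = B + 4 B for the
   current and previous one; the increment divided by s; the compensating term of [lyap]; 1 for
   positivity. *)
pose C := c * p * N + (2 * beta + 2 * alpha * beta * delta) * (5 * B)
  + 4 * beta * alpha ^+ 2 * (4 * B) * c^-1 + delta * L + 1.
exists C, delta; split => //.
  rewrite /C; have := mulr_ge0 (mulr_ge0 (ltW c0) (ltW (lt_trans ltr01 p0))) N0.
  have : 0 <= (2 * beta + 2 * alpha * beta * delta) * (5 * B).
    by rewrite mulr_ge0 ?addr_ge0 ?mulr_ge0 // ltW.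
  have : 0 <= 4 * beta * alpha ^+ 2 * (4 * B) * c^-1.
    by rewrite !mulr_ge0 ?invr_ge0 ?sqr_ge0 // ltW.
  by have := mulr_ge0 (ltW d0) L0; lra.
near=> k.
have k2 : (2 <= k)%N by near: k; exact: nbhs_infty_ge.
have k0 : (0 < k)%N by exact: leq_trans k2.
have ah1 : alpha * h k <= 1 by near: k; exact: near_ah_le1.
have step : energy_seq k.+1 + dot (grad k.+1) (grad k.+1) / 2 + beta * h k * gap k.+1
    + beta * h k * s k / 8 * dot (err k.+1) (err k.+1)
    + alpha / 32 * h k * dot (vel k.+1) (vel k.+1)
  <= energy_seq k + (s k - s k.+1) * N
     + 2 * beta * h k * (dot (w k) (w k) + dot (w k.-1) (w k.-1))
     + 4 * beta * h k * (alpha * h k) ^+ 2 / s k * dot (w k.-1) (w k.-1).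
  by near: k; exact: near_energy_step.
have h0 : 0 < h k by exact: natr_powR_gt0.
have h1 : h k <= 1 by rewrite natr_powR_le1 // oppr_le0 ltW.
have h'0 : 0 < h k.+1 by exact: natr_powR_gt0.
have h'h : h k.+1 <= h k by rewrite natr_powRS_le // ltW.
have ah'1 : alpha * h k.+1 <= 1 by apply: le_trans ah1; rewrite ler_wpM2l // ltW.
have s0 := s_gt0 k0; have G0 := @gap_ge0 k.+1 k0.
have up := @energy_le R H dot alpha beta (h k.+1) (gap k.+1) (err k.+1) (vel k.+1) (w k)
  b0 beta_le h'0 ah'1 (betah_le (ltn0Sn k)).
rewrite -(@err_pred k.+1) // -/(energy_seq k.+1) /= in up.
set r := k%:R `^ (- rho).
have r0 : 0 <= r by exact: powR_ge0.
have rh : r <= h k by rewrite ler_natr_powR // lerN2.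
have rhs : r * h k ^+ 2 <= h k * s k / c.
  rewrite /s (mulrA (h k)) (mulrAC _ c) mulfK ?lt0r_neq0 // expr2 mulrA mulrAC.
  by rewrite mulrC ler_wpM2l ?(ltW h0) // -!natr_powRD // ler_natr_powR //; lra.
have hh : h k.+1 ^+ 2 <= h k ^+ 2 by rewrite ler_pXn2r // nnegrE ltW.
have h2 : h k ^+ 2 <= 1 by rewrite expr_le1 // ltW.
have t't : k.+1%:R `^ (-2) <= k%:R `^ (-2) :> R by rewrite natr_powRS_le.
have W0 := dot_ge0 dot (w k); have P0 := dot_ge0 dot (err k.+1).
have A0 := dot_ge0 dot (vel k.+1); have g0 := dot_ge0 dot (grad k.+1).
have wk := path_slow k0; have wk' := path_slow_pred k2.
have S1 := ler_wpM2r N0 (s_sub_le k0).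
have S2 := hw_le_src k0.
have S3 := h3w_le_src k0.
rewrite /lyap -/L.
have t0 : 0 < k%:R `^ (-2) :> R by exact: natr_powR_gt0.
have t'0 : 0 < k.+1%:R `^ (-2) :> R by exact: natr_powR_gt0.
rewrite /C; clear C; clearbody L; move: (h k) (h k.+1) (s k) (s k.+1) (gap k.+1) (energy_seq k.+1) (energy_seq k)
  (dot (w k) _) (dot (w k.-1) _) (dot (err k.+1) _) (dot (vel k.+1) _) (dot (grad k.+1) _)
  (k%:R `^ (-2)) (k.+1%:R `^ (-2)) (src k) r ah1 step h0 h1 h'0 h'h
  ah'1 s0 G0 up r0 rh rhs hh h2 t't W0 P0 A0 g0 wk wk' S1 S2 S3 t0 t'0.
clear dependent k; move=> hk hk' sk sk' G' En' En W W' P A g t t' S r ah1 step.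
move=> h0 h1 h'0 h'h ah'1 s0 G0 up r0 rh rhs hh h2 t't W0 P0 A0 g0 wk wk' S1 S2 S3 t0 t'0.
have ab0 : 0 < alpha * beta by exact: mulr_gt0.
have U1 : r * En' <= hk * G' + 2 * (hk * A) + 2 * alpha * beta * (hk * sk / c * P + hk * W).
  apply: le_trans (ler_wpM2l r0 up) _.
  have V1 : r * G' <= hk * G' by rewrite ler_wpM2r.
  have V2 : r * A <= hk * A by rewrite ler_wpM2r.
  have V3 : r * hk' ^+ 2 * P <= hk * sk / c * P.
    by rewrite ler_wpM2r //; apply: le_trans rhs; rewrite ler_wpM2l.
  have V4 : r * hk' ^+ 2 * W <= hk * W.
    rewrite ler_wpM2r //; apply: (@le_trans _ _ r) => //.
    by rewrite ler_piMr //; apply: le_trans h2.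
  have := ler_wpM2l (ltW ab0) V3; have := ler_wpM2l (ltW ab0) V4.
  by lra.
have U2 : hk' ^+ 2 * t' <= hk ^+ 2 * t.
  by apply: ler_pM => //; [exact: sqr_ge0|exact: ltW].
have U3 : r * (hk' ^+ 2 * t') <= S.
  apply: le_trans S2; apply: ler_pM => //; first by rewrite mulr_ge0 ?sqr_ge0 // ltW.
  apply: le_trans U2 _; rewrite ler_piMl //; exact: ltW.
have hW : hk * (W + W') <= 5 * B * S.
  have := ler_wpM2l (ltW h0) wk; have := ler_wpM2l (ltW h0) wk'.
  by have := ler_wpM2l B0 S2; lra.
have hW1 : hk * W <= 5 * B * S.
  have := ler_wpM2l (ltW h0) wk; have := ler_wpM2l B0 S2.
  have : 0 <= B * (hk * t) by rewrite !mulr_ge0 // ltW.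
  by lra.
have hW' : hk * hk ^+ 2 / sk * W' <= 4 * B * c^-1 * S.
  have hs0 : 0 <= hk * hk ^+ 2 / sk by rewrite divr_ge0 ?mulr_ge0 ?sqr_ge0 // ltW.
  have := ler_wpM2l hs0 wk'; have := ler_wpM2l B0 S3.
  by lra.
have S0 : 0 <= S by apply: le_trans S2; rewrite mulr_ge0 // ltW.
have F1 := ler_wpM2l (ltW d0) U1.
have F2 := ler_wpM2l L0 U2.
have F3 := ler_wpM2l (mulr_ge0 (ltW d0) L0) U3.
have hG0 : 0 <= hk * G' by rewrite mulr_ge0 // ltW.
have hA0 : 0 <= hk * A by rewrite mulr_ge0 // ltW.
have hsP0 : 0 <= beta * (hk * sk * P) by rewrite !mulr_ge0 // ltW.
have F4 := ler_wpM2r hG0 d1.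
have F5 := ler_wpM2r hA0 d3.
have F6 := ler_wpM2r g0 d2.
have F7 : 2 * delta * alpha * beta * (hk * sk / c * P) <= 1 / 16 * (beta * (hk * sk * P)).
  have d4' : 2 * alpha * delta / c <= 1 / 16.
    by move: d4; rewrite ler_pdivlMr ?mulr_gt0 // ler_pdivrMr //; lra.
  by have := ler_wpM2r hsP0 d4'; lra.
have F8 := ler_wpM2l (ltW (mulr_gt0 ab0 d0)) hW1.
have F9 := ler_wpM2l (ltW b0) hW.
have a20 : 0 <= beta * alpha ^+ 2 by rewrite mulr_ge0 ?sqr_ge0 // ltW.
have F10 := ler_wpM2l a20 hW'.
have F11 : 0 <= alpha * (hk * A) by rewrite mulr_ge0 // ltW.
clear d1 d2 d3 d4 up U1 U2 U3 hW hW1 hW' rhs wk wk' ah'1 ah1 h1 h'h hh h2 t't rh W0 P0 A0.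
lra.
Unshelve. all: by end_near. Qed.

(** The two upper bounds on [rho + tau] say that each source term is at most k^(-(rho + tau)), as
    the Gronwall lemma requires. *)
Lemma near_lyap_rate (rho tau : R) : q <= rho -> p - q <= rho -> rho < 1 -> 0 <= tau ->
  rho + tau <= p + 1 -> rho + tau <= 3 * q + 2 - p ->
  exists2 M : R, 0 < M & \forall k \near \oo, lyap k <= M * k%:R `^ (- tau).
Proof.
move=> qr pr r1 t0 tp tq; have [C [d [C0 d0 stepE]]] := near_lyap_step qr pr.
apply: (@discrete_gronwall R lyap rho tau (2 * C) d) => //.
near=> k.
have k0 : (0 < k)%N by near: k; exact: nbhs_infty_gt.
have /= st : lyap k.+1 + d * (k%:R `^ (- rho) * lyap k.+1 + h k * gap k.+1
      + h k * dot (vel k.+1) (vel k.+1) + dot (grad k.+1) (grad k.+1))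
    <= lyap k + C * src k by near: k.
have G0 := @gap_ge0 k.+1 k0.
have h1 := mulr_ge0 (ltW d0) (mulr_ge0 (powR_ge0 (k%:R : R) (- q)) G0).
have h2 := mulr_ge0 (ltW d0) (mulr_ge0 (powR_ge0 (k%:R : R) (- q)) (dot_ge0 dot (vel k.+1))).
have h3 := mulr_ge0 (ltW d0) (dot_ge0 dot (grad k.+1)).
have src_le : src k <= 2 * k%:R `^ (- (rho + tau)).
  rewrite /src [leRHS]mulr_natl mulr2n lerD // ler_natr_powR //; lra.
have := ler_wpM2l (ltW C0) src_le; rewrite /h in st *; lra.
Unshelve. all: by end_near. Qed.

(** The disjunction offers two routes to the error: the h^2 |y|^2 part of the energy, or strong
    convexity of the gap. The bound on u comes from the recurrence; [tau <= 2 * p] and [e <= 0],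
    which keeps x bounded, make its Tikhonov part harmless. *)
Lemma near_rates (rho tau e : R) : q <= rho -> p - q <= rho -> rho < 1 -> 0 <= tau ->
  rho + tau <= p + 1 -> rho + tau <= 3 * q + 2 - p -> tau <= 2 * p ->
  e <= 0 -> 2 * q - tau <= e \/ p - tau <= e ->
  exists2 M : R, 0 < M & \forall k \near \oo,
  [/\ gap k <= M * k%:R `^ (- tau), dot (vel k) (vel k) <= M * k%:R `^ (- tau),
      dot (u k) (u k) <= M * k%:R `^ (- tau) & dot (err k) (err k) <= M * k%:R `^ e].
Proof.
move=> qr pr r1 t0 tp tq tp2 e0 te.
have [M M0 lyap_le] := near_lyap_rate qr pr r1 t0 tp tq.
have [C C0 lyap_ge] := near_lyap_ge.
pose D := C * M + 2 * M / c.
have D0 : 0 < D by rewrite addr_gt0 ?divr_gt0 ?mulr_gt0.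
have near1 : \forall k \near \oo, [/\ gap k <= M * k%:R `^ (- tau),
    dot (vel k) (vel k) <= D * k%:R `^ (- tau) & dot (err k) (err k) <= D * k%:R `^ e].
  near=> k.
  have k2 : (2 <= k)%N by near: k; exact: nbhs_infty_ge.
  have k0 : (0 < k)%N by exact: leq_trans k2.
  have Ek : lyap k <= M * k%:R `^ (- tau) by near: k.
  have [Gk vk yk] : [/\ gap k <= lyap k, dot (vel k) (vel k) <= C * lyap k &
      h k ^+ 2 * dot (err k) (err k) <= C * lyap k] by near: k.
  have G' : gap k <= M * k%:R `^ (- tau) by exact: le_trans Ek.
  have CE := ler_wpM2l (ltW C0) Ek.
  have kt0 : 0 <= k%:R `^ (- tau) :> R by exact: powR_ge0.
  have ke0 : 0 <= k%:R `^ e :> R by exact: powR_ge0.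
  have Mc0 : 0 <= 2 * M / c by rewrite divr_ge0 ?mulr_ge0 // ltW.
  split=> //.
    by apply: le_trans vk _; apply: le_trans CE _; have := mulr_ge0 Mc0 kt0; rewrite /D; lra.
  case: te => te.
    apply: (@le_trans _ _ (C * M * k%:R `^ (2 * q - tau))); last first.
      have := ler_wpM2l (ltW (mulr_gt0 C0 M0)) (ler_natr_powR k0 te).
      by have := mulr_ge0 Mc0 ke0; rewrite /D; lra.
    have hk0 : 0 < h k ^+ 2 by rewrite exprn_gt0 // natr_powR_gt0.
    rewrite -(ler_pM2l hk0); apply: le_trans yk _; apply: le_trans CE _.
    rewrite le_eqVlt; apply/orP; left; apply/eqP.
    have -> : h k ^+ 2 * (C * M * k%:R `^ (2 * q - tau)) =
        C * (M * (h k * h k * k%:R `^ (2 * q - tau))) by ring.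
    by rewrite /h -!natr_powRD //; congr (_ * (_ * _ `^ _)); ring.
  apply: (@le_trans _ _ (2 * M / c * k%:R `^ (p - tau))); last first.
    have := ler_wpM2l Mc0 (ler_natr_powR k0 te).
    by have := mulr_ge0 (ltW (mulr_gt0 C0 M0)) ke0; rewrite /D; lra.
  have sk0 : 0 < s k / 2 by rewrite divr_gt0 // s_gt0.
  rewrite -(ler_pM2l sk0); apply: le_trans (gap_err k2) _; apply: le_trans G' _.
  rewrite le_eqVlt; apply/orP; left; apply/eqP.
  have -> : s k / 2 * (2 * M / c * k%:R `^ (p - tau)) = M * (k%:R `^ (- p) * k%:R `^ (p - tau)).
    by rewrite /s; field; exact: lt0r_neq0.
  by rewrite -natr_powRD //; congr (_ * _ `^ _); ring.
clearbody D.
(* The summands bound |v_k|^2 after an index shift, |v_{k+1}|^2, and s_k^2 |x_k|^2 with |x_k|^2 <= 2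
   |y_k|^2 + 2 |z_k|^2. *)
pose D2 := 3 * (D * 2 `^ tau + D + c ^+ 2 * 2 `^ (2 * p) * (2 * D + 2 * N)).
have t2 : 0 <= 2 `^ tau :> R by exact: powR_ge0.
have D20 : 0 <= D2.
  by rewrite /D2 !(mulr_ge0, addr_ge0) ?powR_ge0 ?sqr_ge0 // ltW.
exists (M + D + D2); first by rewrite ltr_wpDr // addr_gt0.
suff nearS : \forall k \near \oo, dot (u k.+1) (u k.+1) <= D2 * k.+1%:R `^ (- tau).
  have near2 : \forall k \near \oo, dot (u k) (u k) <= D2 * k%:R `^ (- tau).
    by case: nearS => K _ KP; exists K.+1 => // -[//|k] /= /KP.
  near=> k.
  have [G1 v1 y1] : [/\ gap k <= M * k%:R `^ (- tau),
    dot (vel k) (vel k) <= D * k%:R `^ (- tau) & dot (err k) (err k) <= D * k%:R `^ e].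
    by near: k.
  have u1 : dot (u k) (u k) <= D2 * k%:R `^ (- tau) by near: k.
  have kt0 : 0 <= k%:R `^ (- tau) :> R by exact: powR_ge0.
  have ke0 : 0 <= k%:R `^ e :> R by exact: powR_ge0.
  have m1 := mulr_ge0 (ltW D0) kt0; have m2 := mulr_ge0 (ltW M0) kt0.
  have m3 := mulr_ge0 D20 kt0.
  have m4 := mulr_ge0 (ltW M0) ke0; have m5 := mulr_ge0 D20 ke0.
  split; lra.
have near1S := near_succ near1.
near=> k.
have k0 : (0 < k)%N by near: k; exact: nbhs_infty_gt.
have [_ v1 y1] : [/\ gap k <= M * k%:R `^ (- tau),
    dot (vel k) (vel k) <= D * k%:R `^ (- tau) & dot (err k) (err k) <= D * k%:R `^ e].
  by near: k.
have [_ v2 _] : [/\ gap k.+1 <= M * k.+1%:R `^ (- tau),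
    dot (vel k.+1) (vel k.+1) <= D * k.+1%:R `^ (- tau)
    & dot (err k.+1) (err k.+1) <= D * k.+1%:R `^ e].
  by near: k; exact: near1S.
have ah1 : alpha * h k <= 1 by near: k; exact: near_ah_le1.
have uE : u k.+1 = (1 - alpha * h k) *: vel k + - vel k.+1 + - (s k *: x k).
  by rewrite (recE k0); set A := _ *: vel k; rewrite opprB [A + _]addrC subrK /grad /= addrK.
have := @dot_sum3_le R H dot ((1 - alpha * h k) *: vel k) (- vel k.+1) (- (s k *: x k)).
rewrite -uE !(dotNl, dotNr, opprK, dotZl, dotZr) => U.
have X : dot (x k) (x k) <= 2 * D + 2 * N.
  have := dot_ge0 dot (err k - z k); have := path_bounded k0.
  have : x k = err k + z k by rewrite /err subrK.
  move=> ->; move: (err k) (z k) y1 => y zk y1; rewrite !dotE (dotC dot zk y).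
  have : D * k%:R `^ e <= D by rewrite ler_piMr ?natr_powR_le1 // ltW.
  lra.
have X0 := dot_ge0 dot (x k).
have kt := natr_powR_le_double k0 t0.
have pos0 : 0 <= 2 * p by case/andP: p1; lra.
have kp : k%:R `^ (- p) * k%:R `^ (- p) <= 2 `^ (2 * p) * k.+1%:R `^ (- tau) :> R.
  rewrite -natr_powRD // (_ : - p + - p = - (2 * p)); last by ring.
  apply: le_trans (natr_powR_le_double k0 pos0) _; rewrite ler_wpM2l ?powR_ge0 //.
  by rewrite ler_natr_powR // lerN2.
have ah0 : 0 <= 1 - alpha * h k by rewrite subr_ge0.
have ah1' : 1 - alpha * h k <= 1 by rewrite gerBl mulr_ge0 ?powR_ge0 // ltW.
have V1 : (1 - alpha * h k) * ((1 - alpha * h k) * dot (vel k) (vel k))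
    <= D * 2 `^ tau * k.+1%:R `^ (- tau).
  apply: (@le_trans _ _ (dot (vel k) (vel k))).
    have v0 := dot_ge0 dot (vel k).
    by rewrite mulrA ler_piMl // mulr_ile1.
  by apply: le_trans v1 _; rewrite -mulrA ler_wpM2l // ltW.
have V3 : s k * (s k * dot (x k) (x k)) <=
    c ^+ 2 * 2 `^ (2 * p) * (2 * D + 2 * N) * k.+1%:R `^ (- tau).
  have -> : s k * (s k * dot (x k) (x k)) =
    c ^+ 2 * (k%:R `^ (- p) * k%:R `^ (- p)) * dot (x k) (x k) by rewrite /s; ring.
  have -> : c ^+ 2 * 2 `^ (2 * p) * (2 * D + 2 * N) * k.+1%:R `^ (- tau) =
    c ^+ 2 * (2 `^ (2 * p) * k.+1%:R `^ (- tau)) * (2 * D + 2 * N) by ring.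
  apply: ler_pM => //; first by rewrite mulr_ge0 ?sqr_ge0 // mulr_ge0 ?powR_ge0.
  by rewrite ler_wpM2l // sqr_ge0.
rewrite /D2; lra.
Unshelve. all: by end_near. Qed.

(** The weight k^(2q) turns the damping k^(-q) of gap and velocity into k^q and the unweighted |g|^2
    into k^(2q) |g|^2, from which |u|^2 is recovered. *)
Lemma near_sums : 2 * q < p -> exists T : nat -> R, (\forall k \near \oo, 0 <= T k) /\
  \forall k \near \oo, k%:R `^ q * gap k.+1 + k%:R `^ q * dot (vel k.+1) (vel k.+1)
     + k%:R `^ (2 * q) * dot (u k.+1) (u k.+1) <= T k - T k.+1.
Proof.
move=> q2p; have [/andP[q0 q1] /andP[p0 pq]] := (q01, p1).
(* The best decay allowed by the two source terms when rho = p - q; it exceeds the weight 2 q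
   because p < q + 1. *)
pose tau := Num.min (q + 1) (4 * q + 2 - 2 * p).
have [t1 t2] : tau <= q + 1 /\ tau <= 4 * q + 2 - 2 * p by rewrite !ge_min !lexx orbT.
have t3 : 2 * q < tau by rewrite lt_min; apply/andP; split; lra.
have qrho : q <= p - q by lra.
have [C [d [C0 d0 stepE]]] := near_lyap_step qrho (lexx _).
have [M M0 lyap_le] : exists2 M : R, 0 < M & \forall k \near \oo, lyap k <= M * k%:R `^ (- tau).
  by apply: (@near_lyap_rate (p - q)); lra.
have [C' C'0 lyap_ge] := near_lyap_ge.
have q20 : 0 <= 2 * q by lra.
have lyap_bd : \forall k \near \oo, 0 <= lyap k <= M * k%:R `^ (- tau).
  near=> k.
  have k2 : (2 <= k)%N by near: k; exact: nbhs_infty_ge.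
  have [Gk _ _] : [/\ gap k <= lyap k, dot (vel k) (vel k) <= C' * lyap k &
      h k ^+ 2 * dot (err k) (err k) <= C' * lyap k] by near: k.
  by rewrite (le_trans (gap_ge0 k2) Gk) /=; near: k.
have [T [T0 dT]] : exists T, (\forall k \near \oo, 0 <= T k) /\
    \forall k \near \oo, k%:R `^ (2 * q) *
      (d * (k%:R `^ (- (p - q)) * lyap k.+1 + h k * gap k.+1
      + h k * dot (vel k.+1) (vel k.+1) + dot (grad k.+1) (grad k.+1))) <= T k - T k.+1.
  apply: (weighted_telescope q20 t3 lyap_bd stepE).
  (* The weighted source is k^(-(p-2q)-1) + k^(-(q+1-p)-1), and both margins are positive. *)
  exists (Num.min (p - 2 * q) (q + 1 - p)); first by rewrite lt_min; apply/andP; split; lra.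
  exists (2 * C); near=> k.
  have k0 : (0 < k)%N by near: k; exact: nbhs_infty_gt.
  rewrite mulrCA [2 * C]mulrC -mulrA ler_wpM2l ?(ltW C0) // /src mulrDr -!natr_powRD //.
  rewrite [leRHS]mulr_natl mulr2n lerD // ler_natr_powR //.
    by rewrite (_ : 2 * q + _ = - (p - 2 * q) - 1); [rewrite lerD2r lerN2 ge_min lexx|ring].
  by rewrite (_ : 2 * q + _ = - (q + 1 - p) - 1); [rewrite lerD2r lerN2 ge_min lexx orbT|ring].
(* Adding p > 1 and p > 2 q makes k^(2q) s_k^2 summable. *)
have e0 : 0 < 2 * p - 2 * q - 1 by lra.
have [C2 C20 tele] := natr_powR_telescope e0.
have [M2 M20 rates] : exists2 M : R, 0 < M & \forall k \near \oo,
  [/\ gap k <= M * k%:R `^ (- tau), dot (vel k) (vel k) <= M * k%:R `^ (- tau),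
      dot (u k) (u k) <= M * k%:R `^ (- tau) & dot (err k) (err k) <= M * k%:R `^ 0].
  by apply: (@near_rates (p - q) tau 0); try lra; left; lra.
pose D := c ^+ 2 * (2 * M2 + 2 * N).
have D0 : 0 <= D by rewrite mulr_ge0 ?sqr_ge0 // addr_ge0 ?mulr_ge0 // ltW.
exists (fun k => 2 / d * T k + 2 * D * C2 * k%:R `^ (- (2 * p - 2 * q - 1))); split.
  near=> k; have : 0 <= T k by near: k.
  move=> Tk; apply: addr_ge0; first exact: mulr_ge0 (divr_ge0 (ler0n R 2) (ltW d0)) Tk.
  exact: mulr_ge0 (mulr_ge0 (mulr_ge0 (ler0n R 2) D0) (ltW C20)) (powR_ge0 _ _).
near=> k.
have k0 : (0 < k)%N by near: k; exact: nbhs_infty_gt.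
have dTk : k%:R `^ (2 * q) *
      (d * (k%:R `^ (- (p - q)) * lyap k.+1 + h k * gap k.+1
      + h k * dot (vel k.+1) (vel k.+1) + dot (grad k.+1) (grad k.+1))) <= T k - T k.+1.
  by near: k.
have L0 : 0 <= lyap k.+1.
  have /andP[] // : 0 <= lyap k.+1 <= M * k.+1%:R `^ (- tau).
  by near: k; exact: (near_succ lyap_bd).
have y1 : dot (err k) (err k) <= M2.
  have [_ _ _] : [/\ gap k <= M2 * k%:R `^ (- tau), dot (vel k) (vel k) <= M2 * k%:R `^ (- tau),
      dot (u k) (u k) <= M2 * k%:R `^ (- tau) & dot (err k) (err k) <= M2 * k%:R `^ 0].
    by near: k.
  by rewrite powRr0 mulr1.
have X : dot (x k) (x k) <= 2 * M2 + 2 * N.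
  have := dot_ge0 dot (err k - z k); have := path_bounded k0.
  have : x k = err k + z k by rewrite /err subrK.
  by move=> ->; move: (err k) (z k) y1 => y zk y1; rewrite !dotE (dotC dot zk y); lra.
have U : dot (u k.+1) (u k.+1) <= 2 * dot (grad k.+1) (grad k.+1) + 2 * (s k * (s k * dot (x k) (x k))).
  have := dot_ge0 dot (grad k.+1 + s k *: x k).
  have -> : u k.+1 = grad k.+1 - s k *: x k by rewrite /grad /= addrK.
  move: (grad k.+1) => g; rewrite !dotE (dotC dot (x k) g); lra.
have kq : k%:R `^ (2 * q) * h k = k%:R `^ q :> R.
  by rewrite /h -natr_powRD //; congr (_ `^ _); ring.
have k2q : 0 <= k%:R `^ (2 * q) :> R by exact: powR_ge0.
have G0 : 0 <= k%:R `^ q * gap k.+1 by rewrite mulr_ge0 ?powR_ge0 // (@gap_ge0 k.+1).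
have V0 : 0 <= k%:R `^ q * dot (vel k.+1) (vel k.+1) by rewrite mulr_ge0 ?powR_ge0 ?dot_ge0.
have S : k%:R `^ (2 * q) * (s k * (s k * dot (x k) (x k))) <=
    D * k%:R `^ (- (2 * p - 2 * q - 1) - 1).
  have -> : k%:R `^ (2 * q) * (s k * (s k * dot (x k) (x k))) =
     c ^+ 2 * (k%:R `^ (2 * q) * k%:R `^ (- p) * k%:R `^ (- p)) * dot (x k) (x k).
    by rewrite /s; ring.
  rewrite -!natr_powRD // (_ : 2 * q - p - p = - (2 * p - 2 * q - 1) - 1); last by ring.
  by rewrite /D mulrAC ler_wpM2r ?powR_ge0 // ler_wpM2l // sqr_ge0.
have S2 := ler_wpM2l D0 (tele k k0).
have U2 := ler_wpM2l k2q U.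
have gT : k%:R `^ q * gap k.+1 + k%:R `^ q * dot (vel k.+1) (vel k.+1)
    + k%:R `^ (2 * q) * dot (grad k.+1) (grad k.+1) <= (T k - T k.+1) / d.
  rewrite ler_pdivlMr //; apply: le_trans dTk; rewrite -kq.
  have := mulr_ge0 (mulr_ge0 k2q (ltW d0)) (mulr_ge0 (powR_ge0 (k%:R : R) (- (p - q))) L0).
  lra.
lra.
Unshelve. all: by end_near. Qed.

End InertialTikhonov.

(** * The Tikhonov path *)

Section TikhonovPath.
Context {R : realType} {H : completeNormedModType R} (dot : {dot H for idfun}).
Hypothesis norm_dot : forall v : H, `|v| = Num.sqrt (dot v v).
Variables (f : H -> \bar R).
Hypotheses (f_proper : eproper f) (f_convex : econvex f) (f_lsc : lower_semicontinuous f).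

Lemma fin_num_le x r : (f x <= r%:E)%E -> f x \is a fin_num.
Proof.
move=> fxr; rewrite fin_numE f_proper.1 /=.
by apply: contraTneq fxr => ->; rewrite leNgt ltry.
Qed.

Lemma proper_fin_num : exists x, f x \is a fin_num.
Proof.
have [x fx] := f_proper.2; exists x; rewrite fin_numE f_proper.1 /=.
by rewrite lt_eqF.
Qed.

Lemma argmin_fin_num x : argmin f x -> f x \is a fin_num.
Proof.
by move=> xmin; have [y fy] := proper_fin_num; apply: (@fin_num_le _ (fine (f y))); rewrite fineK.
Qed.

Section Quadratic.
Variables (s : R) (z : H).
Hypotheses (zmin : argmin (fun y => f y + (s * `|y| ^+ 2)%:E)%E z).

Lemma quad_argmin_fin_num : f z \is a fin_num.
Proof.
have [y fy] := proper_fin_num; have := zmin y; rewrite -(fineK fy) -EFinD => h.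
rewrite fin_numE f_proper.1 /=; apply: contraTneq h => ->.
by rewrite addye // leNgt ltry.
Qed.

Lemma quad_argmin_le y : f y \is a fin_num ->
  fine (f z) + s * dot z z <= fine (f y) + s * dot y y.
Proof.
move=> fy; have := zmin y; rewrite -(fineK fy) -(fineK quad_argmin_fin_num).
by rewrite -!EFinD lee_fin !(normr_dot norm_dot).
Qed.

(** Minimality is tested at t y + (1 - t) z: convexity of [f] and the exact quadratic identity give
    s (1 - t) D <= Delta for 0 < t < 1, and t tends to 0. *)
Lemma quad_argmin_strong y : f y \is a fin_num ->
  fine (f z) + s * dot z z + s * dot (y - z) (y - z) <= fine (f y) + s * dot y y.
Proof.
move=> fy; have fz := quad_argmin_fin_num.
set D := dot (y - z) (y - z); have D0 : 0 <= D by exact: dot_ge0.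
have key t : 0 < t < 1 ->
    s * (1 - t) * D <= fine (f y) + s * dot y y - (fine (f z) + s * dot z z).
  move=> /andP[t0 t1]; set v := t *: y + (1 - t) *: z.
  have fv : (f v <= (t * fine (f y) + (1 - t) * fine (f z))%:E)%E.
    by rewrite EFinD !EFinM !fineK //; apply: f_convex; rewrite !ltW.
  have fvfin := fin_num_le fv; have := quad_argmin_le fvfin.
  rewrite -(fineK fvfin) lee_fin in fv.
  have -> : dot v v = t * dot y y + (1 - t) * dot z z - t * (1 - t) * D.
    by rewrite /v /D !dotE (dotC dot z y); ring.
  move=> h; rewrite -(ler_pM2l t0); lra.
rewrite -lerBrDl leNgt; apply/negP => lt_sD.
have Delta0 := quad_argmin_le fy; rewrite -subr_ge0 in Delta0.
have sD0 : 0 < s * D by exact: le_lt_trans lt_sD.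
move: key lt_sD Delta0; set Delta := _ - _ => key lt_sD Delta0.
(* In place of a limit, a single t for which s (1 - t) D is the midpoint of s D and Delta, hence
   above Delta. *)
have := key ((s * D - Delta) / (2 * (s * D))).
have -> : s * (1 - (s * D - Delta) / (2 * (s * D))) * D = (s * D + Delta) / 2.
  clearbody D Delta; have /lt0r_neq0 := sD0; rewrite mulf_eq0 negb_or => /andP[sn0 Dn0].
  by field; rewrite sn0 Dn0.
have sD20 : 0 < 2 * (s * D) by rewrite pmulr_rgt0.
have lt01 : 0 < (s * D - Delta) / (2 * (s * D)) < 1.
  apply/andP; split; first by rewrite divr_gt0 ?subr_gt0.
  by rewrite ltr_pdivrMr //; lra.
by move=> /(_ lt01); lra.
Qed.

End Quadratic.

Variables (xstar : H) (xstar_min : is_min_norm (argmin f) xstar).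
Variables (c p : R) (c0 : 0 < c) (p0 : 1 < p).
Variables (z : nat -> H) (z_min : forall k, (1 <= k)%N -> argmin (tikhonov f c p k) (z k)).

Let a k : R := c / (2 * k%:R `^ p).

Lemma reg_gt0 k : (0 < k)%N -> 0 < a k.
Proof. by move=> k0; rewrite divr_gt0 // mulr_gt0 // natr_powR_gt0. Qed.

Lemma regE k : a k = c * k%:R `^ (- p) / 2.
Proof. by rewrite /a powRN invfM mulrCA mulrC. Qed.

Lemma reg_decr k l : (0 < k < l)%N -> a l < a k.
Proof.
move=> /andP[k0 kl]; have l0 : (0 < l)%N by exact: leq_trans kl.
rewrite ltr_pM2l // ltf_pV2 ?posrE ?mulr_gt0 ?natr_powR_gt0 // ltr_pM2l //.
by rewrite gt0_ltr_powR ?nnegrE ?ltr_nat // (lt_trans ltr01).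
Qed.

Lemma path_fin_num k : (0 < k)%N -> f (z k) \is a fin_num.
Proof. by move=> k0; exact: quad_argmin_fin_num (z_min k0). Qed.

Lemma path_strong k y : (0 < k)%N -> f y \is a fin_num ->
  fine (f (z k)) + a k * dot (z k) (z k) + a k * dot (y - z k) (y - z k)
  <= fine (f y) + a k * dot y y.
Proof. by move=> k0; exact: (quad_argmin_strong (z_min k0)). Qed.

Let xstar_fin : f xstar \is a fin_num.
Proof. exact: argmin_fin_num xstar_min.1. Qed.

Lemma min_le y : f y \is a fin_num -> fine (f xstar) <= fine (f y).
Proof. by move=> fy; rewrite -lee_fin !fineK //; exact: xstar_min.1. Qed.

Lemma path_dist_xstar k : (0 < k)%N ->
  dot (xstar - z k) (xstar - z k) <= dot xstar xstar - dot (z k) (z k).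
Proof.
move=> k0; rewrite -(ler_pM2l (reg_gt0 k0)).
by have := path_strong k0 xstar_fin; have := min_le (path_fin_num k0); lra.
Qed.

Lemma path_norm_le k : (0 < k)%N -> dot (z k) (z k) <= dot xstar xstar.
Proof. by move=> k0; rewrite -subr_ge0; apply: le_trans (path_dist_xstar k0); exact: dot_ge0. Qed.

(** Each path point is tested against the other and the inequalities are added; the values of [f]
    cancel. *)
Lemma path_strong2 k l : (0 < k)%N -> (0 < l)%N ->
  (a k + a l) * dot (z l - z k) (z l - z k) <= (a k - a l) * (dot (z l) (z l) - dot (z k) (z k)).
Proof.
move=> k0 l0; have := path_strong k0 (path_fin_num l0); have := path_strong l0 (path_fin_num k0).
by rewrite -(opprB (z l) (z k)) !dotE; lra.
Qed.

Lemma path_dist k l : (0 < k)%N -> (k <= l)%N ->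
  dot (z l - z k) (z l - z k) <= dot (z l) (z l) - dot (z k) (z k).
Proof.
move=> k0; rewrite leq_eqVlt => /orP[/eqP <-|kl].
  by rewrite !subrr linear0r.
have l0 : (0 < l)%N by exact: leq_trans kl.
have akl : 0 < a k - a l by rewrite subr_gt0 reg_decr // k0.
rewrite -(ler_pM2l akl); apply: le_trans (path_strong2 k0 l0).
rewrite ler_wpM2r ?dot_ge0 //; have := reg_gt0 l0; lra.
Qed.

(** The relative decrease of the coefficient is at most p / k, so |w|^2 <= (p / k) (|z_{k+1}|^2 -
    |z_k|^2). The difference of squares is itself linear in the increment w, and Young then upgrades
    the bound to order k^(-2). *)
Lemma path_slow_rate k : (0 < k)%N ->
  dot (z k.+1 - z k) (z k.+1 - z k) <= 4 * p ^+ 2 * dot xstar xstar * k%:R `^ (-2).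
Proof.
move=> k0; have ak0 := reg_gt0 k0; have ak'0 := reg_gt0 (ltn0Sn k).
have Q0 : 0 <= dot (z k.+1) (z k.+1) - dot (z k) (z k).
  by apply: le_trans (path_dist k0 (leqnSn k)); exact: dot_ge0.
have := path_strong2 k0 (ltn0Sn k).
have ap : a k - a k.+1 <= a k * (p / k%:R).
  have p0' : 0 <= p by exact/ltW/(lt_trans ltr01).
  have := natr_powR_sub_le k0 p0'; rewrite natr_powRD // powR_inv1 // => h.
  by rewrite !regE; have := ler_wpM2l (ltW c0) h; lra.
set W := dot (z k.+1 - z k) (z k.+1 - z k); have W0 : 0 <= W by exact: dot_ge0.
move=> h1; have h2 := ler_wpM2r Q0 ap.
have {h1 h2} h : W <= p / k%:R * (dot (z k.+1) (z k.+1) - dot (z k) (z k)).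
  rewrite -(ler_pM2l ak0) mulrA; apply: le_trans h2; apply: le_trans h1.
  by rewrite ler_wpM2r // lerDl ltW.
have pk0 : 0 <= p / k%:R by rewrite divr_ge0 // ltW // (lt_trans ltr01).
have QE : dot (z k.+1) (z k.+1) - dot (z k) (z k) = 2 * dot (z k.+1 - z k) (z k.+1) - W.
  by rewrite /W !dotE (dotC dot (z k) (z k.+1)); ring.
have Y := dot_young dot (z k.+1 - z k) (p / k%:R *: z k.+1) (divr_gt0 ltr01 (ltr0Sn R 1)).
rewrite !(dotZl, dotZr) -/W in Y; rewrite QE in h.
have h3 := mulr_ge0 pk0 W0.
have h4 := ler_wpM2l (mulr_ge0 pk0 pk0) (path_norm_le (ltn0Sn k)).
have -> : 4 * p ^+ 2 * dot xstar xstar * k%:R `^ (-2) =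
   4 * (p / k%:R * (p / k%:R) * dot xstar xstar).
  by rewrite powR_invn //; field; rewrite pnatr_eq0 -lt0n.
lra.
Qed.

Lemma path_cvg : z @ \oo --> xstar.
Proof.
have sqr_lt e v : 0 < e -> dot v v < e ^+ 2 -> `|v| < e.
  by move=> e0; rewrite -(normr_dot norm_dot) ltr_pXn2r // nnegrE // ltW.
(* The shift discards [z 0], which is unconstrained. *)
have nd : {homo (fun n => dot (z n.+1) (z n.+1)) : n m / (n <= m)%N >-> n <= m}.
  move=> n l nl; rewrite -subr_ge0; apply: le_trans (path_dist _ _) => //; exact: dot_ge0.
have bd : has_ubound (range (fun n => dot (z n.+1) (z n.+1))).
  by exists (dot xstar xstar) => _ [n _ <-]; exact: path_norm_le.
have nc := nondecreasing_cvgn nd bd; set S := sup _ in nc.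
have nS n : dot (z n.+1) (z n.+1) <= S.
  by apply: ub_le_sup => //; exists n.
have zc : cvgn z.
  apply: cauchy_cvg; apply: cauchy_exP => e e0.
  have e20 : 0 < e ^+ 2 by exact: exprn_gt0.
  have [K _ KP] : \forall n \near \oo, S - e ^+ 2 < dot (z n.+1) (z n.+1).
    by apply: (cvgr_gt S nc); rewrite gtrBl.
  exists (z K.+1); exists K.+1 => // n /= Kn.
  rewrite -ball_normE /= distrC; apply: sqr_lt => //.
  apply: le_lt_trans (path_dist (ltn0Sn K) Kn) _.
  have := KP K (leqnn K) => /=; case: n Kn => // n _; have := nS n; lra.
move: zc => /cvg_ex[l zl].
have nl : (fun n => dot (z n) (z n)) @ \oo --> dot l l.
  rewrite -(normr_dot norm_dot).
  under eq_fun do rewrite -(normr_dot norm_dot).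
  by rewrite expr2; under eq_fun do rewrite expr2; apply: cvgM; exact: cvg_norm.
have lmin : argmin f l.
  move=> y; apply: le_trans (xstar_min.1 y); rewrite leNgt; apply/negP => ltf.
  rewrite -(fineK xstar_fin) in ltf.
  (* A real level strictly between the minimum and [f l] also covers [f l = +oo]; lower
     semicontinuity keeps f(z_k) above it, while f(z_k) is at most the minimum plus a multiple of
     k^(-p). *)
  have [b [mb bl]] : exists b, fine (f xstar) < b /\ (b%:E < f l)%E.
    move: ltf; case: (f l) => [r| |] //; rewrite ?lte_fin => h.
      by exists ((fine (f xstar) + r) / 2); rewrite lte_fin; split; lra.
    by exists (fine (f xstar) + 1); rewrite ltry; split => //; lra.
  have [V Vl fV] := f_lsc bl.
  have p00 : - p < 0 by rewrite oppr_lt0 (lt_trans ltr01).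
  have e0 : 0 < (b - fine (f xstar)) / (c * dot xstar xstar + 1).
    by rewrite divr_gt0 ?subr_gt0 // ltr_wpDl // mulr_ge0 ?dot_ge0 // ltW.
  have : \forall k \near \oo, False.
    near=> k.
    have k0 : (0 < k)%N by near: k; exact: nbhs_infty_gt.
    have : V (z k) by near: k; exact: zl.
    move=> /fV; rewrite -(fineK (path_fin_num k0)) lte_fin => h1.
    have h2 := path_strong k0 xstar_fin.
    have : k%:R `^ (- p) <= (b - fine (f xstar)) / (c * dot xstar xstar + 1).
      by near: k; exact: near_natr_powR_le.
    have cx : 0 <= c * dot xstar xstar by rewrite mulr_ge0 ?dot_ge0 // ltW.
    rewrite ler_pdivlMr; last by lra.
    have k1 := powR_ge0 (k%:R : R) (- p).
    have h3 := mulr_ge0 (ltW (reg_gt0 k0)) (dot_ge0 dot (z k)).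
    have h4 := mulr_ge0 (ltW (reg_gt0 k0)) (dot_ge0 dot (xstar - z k)).
    have h5 := mulr_ge0 cx k1.
    move: h2 h3 h4; rewrite regE; lra.
  by case=> K _ /(_ K (leqnn K)).
(* Then |x^* - z_k|^2 <= |x^*|^2 - |z_k|^2 <= |l|^2 - |z_k|^2, which tends to 0, so the limit is x^*
   itself. *)
have lx : dot xstar xstar <= dot l l.
  by rewrite -!(normr_dot norm_dot) ler_pXn2r ?nnegrE //; exact: xstar_min.2.
apply/cvgrPdist_lt => e e0.
have e20 : 0 < e ^+ 2 by exact: exprn_gt0.
near=> k.
have k0 : (0 < k)%N by near: k; exact: nbhs_infty_gt.
apply: sqr_lt => //; apply: le_lt_trans (path_dist_xstar k0) _.
have : dot l l - e ^+ 2 < dot (z k) (z k).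
  by near: k; apply: (cvgr_gt (dot l l) nl); rewrite gtrBl.
lra.
Unshelve. all: by end_near. Qed.

End TikhonovPath.

(** * Landau notation *)

Lemma bigO_near {R : realType} (a b : nat -> R) (C : R) :
  (\forall n \near \oo, `|a n| <= C * `|b n|) -> (a : nat -> R^o) =O_\oo (b : nat -> R^o).
Proof.
move=> aCb; apply/eqOP; near=> D; near=> n.
apply: (@le_trans _ _ (C * `|b n|)); first by near: n.
by rewrite ler_wpM2r //; near: D; exact: nbhs_pinfty_ge.
Unshelve. all: by end_near. Qed.

Lemma bigO_natr_powR {R : realType} (a : nat -> R) (M r : R) :
  (\forall n \near \oo, 0 <= a n <= M * n%:R `^ r) ->
  (a : nat -> R^o) =O_\oo ((fun n => n%:R `^ r) : nat -> R^o).
Proof.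
move=> aM; apply: (@bigO_near _ _ _ M); near=> n.
have /andP[a0 an] : 0 <= a n <= M * n%:R `^ r by near: n.
by rewrite !ger0_norm ?powR_ge0.
Unshelve. all: by end_near. Qed.

Lemma ebigO_natr_powR {R : realType} (g : nat -> \bar R) (a : nat -> R) (M r : R) :
  (\forall n \near \oo, [/\ g n = (a n)%:E, 0 <= a n & a n <= M * n%:R `^ r]) ->
  ebigO g (fun n => n%:R `^ r).
Proof.
move=> ga; exists M; near=> n.
have [-> a0 an] : [/\ g n = (a n)%:E, 0 <= a n & a n <= M * n%:R `^ r] by near: n.
by rewrite abse_EFin lee_fin !ger0_norm ?powR_ge0.
Unshelve. all: by end_near. Qed.

(** The constant M + 1 replaces the square root of M, since (M + 1)^2 >= M. *)
Lemma le_natr_powR_half {R : realType} (a M e : R) n : (0 < n)%N -> 0 <= a -> 0 <= M ->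
  a ^+ 2 <= M * n%:R `^ e -> a <= (M + 1) * n%:R `^ (e / 2).
Proof.
move=> n0 a0 M0 aM; have r0 : 0 <= n%:R `^ (e / 2) :> R by exact: powR_ge0.
rewrite -(@ler_pXn2r _ 2) // ?nnegrE ?mulr_ge0 ?addr_ge0 //; apply: le_trans aM _.
rewrite exprMn [X in _ <= _ * X]expr2 -natr_powRD // -splitr ler_wpM2r ?powR_ge0 //.
by rewrite sqrrD1; have := sqr_ge0 M; lra.
Qed.

(** * Convergence and rates in the three parameter regimes *)

Theorem theorem3p3 (R : realType) (H : completeNormedModType R)
  (dot : {dot H for idfun})
  (norm_dot : forall v : H, `|v| = Num.sqrt (dot v v))
  (f : H -> \bar R)
  (f_proper : eproper f) (f_convex : econvex f) (f_lsc : lower_semicontinuous f)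
  (argmin_f : argmin f !=set0)
  (xstar : H) (xstar_min : is_min_norm (argmin f) xstar)
  (alpha c q p : R) (alpha_gt0 : 0 < alpha) (c_gt0 : 0 < c)
  (q_bounds : 0 < q < 1) (p_bounds : 1 < p < q + 1)
  (ak ck : nat -> R)
  (akE : forall k, (1 <= k)%N -> ak k = 1 - alpha / k%:R `^ q)
  (ckE : forall k, (1 <= k)%N -> ck k = c / k%:R `^ p)
  (x : nat -> H)
  (x_rec : forall k, (1 <= k)%N ->
     x k.+1 = prox 1 f (x k + ak k *: (x k - x k.-1) - ck k *: x k))
  (u : nat -> H)
  (u_subdiff : forall k, (2 <= k)%N -> subdiff dot f (x k) (u k))
  (u_eq : forall k, (2 <= k)%N ->
     x k = ak k.-1 *: (x k.-1 - x k.-2) - u k + (1 - ck k.-1) *: x k.-1)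
  (fk : nat -> H -> \bar R)
  (fkE : forall k, (1 <= k)%N -> fk k = tikhonov f c p k)
  (xbar : nat -> H)
  (xbar_min : forall k, (1 <= k)%N -> argmin (fk k) (xbar k)) :
  let minf := ereal_inf (range f) in
  let pw (r : R) := (fun n : nat => n%:R `^ r : R^o) in
  [/\ (p <= 2 * q ->
        [/\ (fun n => `|x n - xbar n| : R^o) =O_\oo (pw ((q - 1) / 2)),
            x @ \oo --> xstar,
            (fun n => `|x n - x n.-1| ^+ 2 : R^o) =O_\oo (pw (q - p - 1)),
            (fun n => `|u n| ^+ 2 : R^o) =O_\oo (pw (q - p - 1)) &
            ebigO (fun n => f (x n) - minf)%E (pw (- p))]),
      (2 * q < p <= (3 * q + 1) / 2 ->
        [/\ (fun n => `|x n - xbar n| : R^o) =O_\oo (pw ((q - 1) / 2)) /\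
              x @ \oo --> xstar,
            [/\ ebigO (fun n => fk n (x n) - fk n (xbar n))%E (pw (- q - 1)),
                (fun n => `|x n - x n.-1| ^+ 2 : R^o) =O_\oo (pw (- q - 1)) &
                (fun n => `|u n| ^+ 2 : R^o) =O_\oo (pw (- q - 1))],
            ebigO (fun n => f (x n) - minf)%E (pw (- p)) &
            [/\ (\sum_(2 <= k <oo)
                  ((k%:R `^ q)%:E * (fk k (x k) - fk k (xbar k))) < +oo)%E,
                (\sum_(2 <= k <oo) (k%:R `^ (2 * q) * `|u k| ^+ 2)%:E < +oo)%E &
                (\sum_(1 <= k <oo)
                  (k%:R `^ q * `|x k.+1 - x k| ^+ 2)%:E < +oo)%E]]) &
      ((3 * q + 1) / 2 < p < q + 1 ->
        [/\ (fun n => `|x n - xbar n| : R^o) =O_\oo (pw (p - q - 1)) /\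
              x @ \oo --> xstar,
            [/\ ebigO (fun n => fk n (x n) - fk n (xbar n))%E
                  (pw (2 * p - 4 * q - 2)),
                (fun n => `|x n - x n.-1| ^+ 2 : R^o)
                  =O_\oo (pw (2 * p - 4 * q - 2)) &
                (fun n => `|u n| ^+ 2 : R^o) =O_\oo (pw (2 * p - 4 * q - 2))],
            (p < (4 * q + 2) / 3 ->
              ebigO (fun n => f (x n) - minf)%E (pw (- p))),
            ((4 * q + 2) / 3 <= p ->
              ebigO (fun n => f (x n) - minf)%E (pw (2 * p - 4 * q - 2))) &
            [/\ (\sum_(2 <= k <oo)
                  ((k%:R `^ q)%:E * (fk k (x k) - fk k (xbar k))) < +oo)%E,
                (\sum_(2 <= k <oo) (k%:R `^ (2 * q) * `|u k| ^+ 2)%:E < +oo)%E &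
                (\sum_(1 <= k <oo)
                  (k%:R `^ q * `|x k.+1 - x k| ^+ 2)%:E < +oo)%E]])].
Proof.
move=> minf pw.
have [/andP[q0 q1] /andP[p0 pq]] := (q_bounds, p_bounds).
have z_min k : (1 <= k)%N -> argmin (tikhonov f c p k) (xbar k).
  by move=> k1; rewrite -fkE //; exact: xbar_min.
pose F k := fine (f (x k)); pose m k := fine (f (xbar k)).
pose N := dot xstar xstar; pose B := 4 * p ^+ 2 * N.
have N0 : 0 <= N by exact: dot_ge0.
have B0 : 0 <= B by rewrite mulr_ge0 // mulr_ge0 // sqr_ge0.
(* A subgradient at x_k forces f(x_k) to be finite. The points [x 0] and [x 1] may lie outside the
   domain of [f], so the estimates start at index 2. *)
have fx k : (2 <= k)%N -> f (x k) \is a fin_num.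
  move=> k2; have [y fy] := proper_fin_num f_proper.
  have := u_subdiff k k2 y; rewrite -(fineK fy) => h.
  rewrite fin_numE f_proper.1 /=; apply: contraTneq h => ->.
  by rewrite addye // leNgt ltry.
have fz k : (1 <= k)%N -> f (xbar k) \is a fin_num.
  by move=> k1; exact: (path_fin_num f_proper z_min k1).
have subgrad k y : (2 <= k)%N -> f y \is a fin_num -> F k + dot (u k) (y - x k) <= fine (f y).
  move=> k2 fy; have := u_subdiff k k2 y.
  by rewrite -(fineK fy) -(fineK (fx _ k2)) -EFinD lee_fin.
have sE k : c / (2 * k%:R `^ p) = c * k%:R `^ (- p) / 2.
  by rewrite powRN invfM mulrCA mulrC.
have recE k : (1 <= k)%N -> vel x k.+1 = (1 - alpha * k%:R `^ (- q)) *: vel x k - grad c p x u k.+1.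
  move=> k1; rewrite /vel /grad /= {1}(u_eq k.+1 k1) /= ckE // akE // !powRN.
  set A := (1 - alpha / _) *: _; rewrite scalerBl scale1r opprD !addrA.
  by rewrite [LHS]addrAC addrK.
have subgrad_prev k : (2 <= k)%N -> F k.+1 + dot (u k.+1) (x k - x k.+1) <= F k.
  by move=> k2; apply: subgrad; [exact: leqW|exact: fx].
have subgrad_path k : (2 <= k)%N -> F k + dot (u k) (xbar k - x k) <= m k.
  by move=> k2; apply: subgrad => //; apply: fz; exact: leq_trans k2.
have path_min k : (1 <= k)%N -> m k + c * k%:R `^ (- p) / 2 * dot (xbar k) (xbar k)
   <= m k.+1 + c * k%:R `^ (- p) / 2 * dot (xbar k.+1) (xbar k.+1).
  move=> k1; rewrite -sE.
  exact: (quad_argmin_le norm_dot f_proper (z_min k k1) (fz k.+1 isT)).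
have path_bounded k : (1 <= k)%N -> dot (xbar k) (xbar k) <= N.
  by move=> k1; exact: (path_norm_le norm_dot f_proper f_convex xstar_min c_gt0 z_min k1).
have path_slow k : (1 <= k)%N ->
    dot (xbar k.+1 - xbar k) (xbar k.+1 - xbar k) <= B * k%:R `^ (-2).
  by move=> k1; exact: (path_slow_rate norm_dot f_proper f_convex xstar_min c_gt0 p0 z_min k1).
have gap_err k : (2 <= k)%N ->
    c * k%:R `^ (- p) / 2 * dot (err x xbar k) (err x xbar k) <= gap dot c p x xbar F m k.
  move=> k2; have k1 : (1 <= k)%N by exact: leq_trans k2.
  have := path_strong norm_dot f_proper f_convex z_min k1 (fx k k2).
  by rewrite /= sE /gap /err -/(F k) -/(m k); lra.
have rates := near_rates alpha_gt0 c_gt0 q_bounds p_bounds N0 B0 recE subgrad_prev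
  subgrad_path path_min path_bounded path_slow gap_err.
have sums := near_sums alpha_gt0 c_gt0 q_bounds p_bounds N0 B0 recE subgrad_prev
  subgrad_path path_min path_bounded path_slow gap_err.
have gap0 k (k2 : (2 <= k)%N) := gap_ge0 c_gt0 gap_err k2.
have fxs : f xstar \is a fin_num by exact: (argmin_fin_num f_proper xstar_min.1).
have minfE : minf = (fine (f xstar))%:E.
  rewrite fineK //; apply/eqP; rewrite eq_le; apply/andP; split.
    by apply: ereal_inf_lbound; exists xstar.
  by apply: le_ereal_inf_tmp => _ [y _ <-]; exact: xstar_min.1.
have zcvg := path_cvg norm_dot f_proper f_convex f_lsc xstar_min c_gt0 p0 z_min.
have fkgap k : (2 <= k)%N -> (fk k (x k) - fk k (xbar k))%E = (gap dot c p x xbar F m k)%:E.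
  move=> k2; have k1 : (1 <= k)%N by exact: leq_trans k2.
  rewrite fkE // /tikhonov -(fineK (fx _ k2)) -(fineK (fz _ k1)) -!EFinD.
  by rewrite !(normr_dot norm_dot) sE.
have fgap k : (2 <= k)%N -> F k - fine (f xstar) <=
    gap dot c p x xbar F m k + c * N * k%:R `^ (- p).
  move=> k2; have k1 : (1 <= k)%N by exact: leq_trans k2.
  have := quad_argmin_le norm_dot f_proper (z_min k k1) fxs.
  rewrite sE -/(m k) -/N /gap => h.
  have s0 : 0 <= c * k%:R `^ (- p) / 2 by rewrite divr_ge0 ?mulr_ge0 ?powR_ge0 // ltW.
  have := mulr_ge0 s0 (dot_ge0 dot (x k)); have := mulr_ge0 s0 N0; lra.
have F0 k : (2 <= k)%N -> 0 <= F k - fine (f xstar).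
  by move=> k2; rewrite subr_ge0; exact: (min_le f_proper xstar_min (fx k k2)).
have near2 : \forall k \near \oo, (2 <= k)%N by exact: nbhs_infty_ge.
(* Each regime is a choice of the dissipation exponent [rho], the energy decay [tau] and the
   exponent [e] of the squared error; the values of [f] decay at the slower of the rates [tau] and
   [p]. *)
have conclude rho tau e : q <= rho -> p - q <= rho -> rho < 1 -> 0 <= tau ->
    rho + tau <= p + 1 -> rho + tau <= 3 * q + 2 - p -> tau <= 2 * p ->
    e < 0 -> 2 * q - tau <= e \/ p - tau <= e ->
  [/\ (fun n => `|x n - xbar n| : R^o) =O_\oo (pw (e / 2)) /\ x @ \oo --> xstar,
     [/\ ebigO (fun n => fk n (x n) - fk n (xbar n))%E (pw (- tau)),
         (fun n => `|x n - x n.-1| ^+ 2 : R^o) =O_\oo (pw (- tau)) &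
         (fun n => `|u n| ^+ 2 : R^o) =O_\oo (pw (- tau))] &
     forall r, - tau <= r -> - p <= r -> ebigO (fun n => f (x n) - minf)%E (pw r)].
  move=> c1 c2 c3 c4 c5 c6 c7 e0 c8.
  have [M M0 rate] := rates rho tau e c1 c2 c3 c4 c5 c6 c7 (ltW e0) c8.
  have err_le : \forall k \near \oo, `|x k - xbar k| <= (M + 1) * k%:R `^ (e / 2).
    near=> k; have k2 : (2 <= k)%N by near: k.
    apply: le_natr_powR_half; rewrite ?(ltW M0) // ?(leq_trans _ k2) //.
    by rewrite (normr_dot norm_dot); near: k; apply: filterS rate => k [].
  split.
  - split.
      apply: (@bigO_natr_powR _ _ (M + 1)); near=> k; rewrite normr_ge0 /=.
      by near: k.
    apply/cvgrPdist_le => eps eps0.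
    have e20 : e / 2 < 0 by rewrite ltr_pdivrMr // mul0r.
    have eps20 : 0 < eps / 2 by rewrite divr_gt0.
    have epsM : 0 < eps / 2 / (M + 1) by rewrite divr_gt0 // addr_gt0.
    near=> k.
    rewrite -(subrKA (xbar k)) (le_trans (ler_normD _ _)) // [leRHS]splitr lerD //.
      by near: k; move/cvgrPdist_le: zcvg; exact.
    rewrite distrC; apply: (@le_trans _ _ ((M + 1) * k%:R `^ (e / 2))); first by near: k.
    rewrite mulrC -ler_pdivlMr ?addr_gt0 //.
    by near: k; exact: near_natr_powR_le.
  - split.
    + apply: (@ebigO_natr_powR _ _ (gap dot c p x xbar F m) M); near=> k.
      have k2 : (2 <= k)%N by near: k.
      by split; [exact: fkgap|exact: gap0|near: k; apply: filterS rate => k []].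
    + apply: (@bigO_natr_powR _ _ M); near=> k; rewrite sqr_ge0 (normr_dot norm_dot) /=.
      by near: k; apply: filterS rate => k [].
    + apply: (@bigO_natr_powR _ _ M); near=> k; rewrite sqr_ge0 (normr_dot norm_dot) /=.
      by near: k; apply: filterS rate => k [].
  - move=> r r1 r2.
    apply: (@ebigO_natr_powR _ _ (fun k => F k - fine (f xstar)) (M + c * N)); near=> k.
    have k2 : (2 <= k)%N by near: k.
    have k1 : (0 < k)%N by exact: leq_trans k2.
    split; [by rewrite minfE EFinB (fineK (fx k k2))|exact: F0|].
    apply: le_trans (fgap k k2) _; rewrite mulrDl lerD //.
      apply: (@le_trans _ _ (M * k%:R `^ (- tau))).
        by near: k; apply: filterS rate => k [].
      by rewrite ler_wpM2l ?(ltW M0) // ler_natr_powR.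
    by rewrite ler_wpM2l ?mulr_ge0 ?(ltW c_gt0) // ler_natr_powR.
have sum_lty : 2 * q < p ->
    [/\ (\sum_(2 <= k <oo) ((k%:R `^ q)%:E * (fk k (x k) - fk k (xbar k))) < +oo)%E,
        (\sum_(2 <= k <oo) (k%:R `^ (2 * q) * `|u k| ^+ 2)%:E < +oo)%E &
        (\sum_(1 <= k <oo) (k%:R `^ q * `|x k.+1 - x k| ^+ 2)%:E < +oo)%E].
  move=> /sums[T [T0 TS]].
  have q20 : 0 <= 2 * q by rewrite mulr_ge0 // ltW.
  (* The potential bounds a_{k+1} with weight k^r; (k+1)^r <= 2^r k^r restores the matching
     weight. *)
  have scale (a : nat -> R) r : 0 <= r -> (forall k, (2 <= k)%N -> 0 <= a k) ->
      (\forall k \near \oo, k%:R `^ r * a k.+1 <= T k - T k.+1) ->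
      (\sum_(2 <= k <oo) (k%:R `^ r * a k)%:E < +oo)%E.
    move=> r0 a0 aT; apply: (@nneseries_telescope_lty _ _ _ (fun k => 2 `^ r * T k)).
    - by move=> k k2; rewrite mulr_ge0 ?powR_ge0 // a0.
    - by near=> k; rewrite mulr_ge0 ?powR_ge0 //; near: k.
    near=> k; have k2 : (2 <= k)%N by near: k.
    rewrite -mulrBr; apply: (@le_trans _ _ (2 `^ r * (k%:R `^ r * a k.+1))).
      rewrite mulrA ler_wpM2r ?a0 //; first exact: leqW.
      by apply: natr_powRS_le_double => //; exact: leq_trans k2.
    by rewrite ler_wpM2l ?powR_ge0 //; near: k.
  split.
  - rewrite (_ : (\sum_(2 <= k <oo) _)%E =
        (\sum_(2 <= k <oo) (k%:R `^ q * gap dot c p x xbar F m k)%:E)%E); last first.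
      apply/congr_lim/funext => n; apply: eq_big_nat => k /andP[k2 _].
      by rewrite fkgap // -EFinM.
    apply: scale; [exact: ltW|exact: gap0|].
    near=> k; have k2 : (2 <= k)%N by near: k.
    have := mulr_ge0 (powR_ge0 (k%:R : R) q) (dot_ge0 dot (vel x k.+1)).
    have := mulr_ge0 (powR_ge0 (k%:R : R) (2 * q)) (dot_ge0 dot (u k.+1)).
    suff : k%:R `^ q * gap dot c p x xbar F m k.+1
      + k%:R `^ q * dot (vel x k.+1) (vel x k.+1)
      + k%:R `^ (2 * q) * dot (u k.+1) (u k.+1) <= T k - T k.+1 by lra.
    by near: k.
  - apply: scale => //; near=> k; have k2 : (2 <= k)%N by near: k.
    rewrite (normr_dot norm_dot).
    have := mulr_ge0 (powR_ge0 (k%:R : R) q) (dot_ge0 dot (vel x k.+1)).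
    have := mulr_ge0 (powR_ge0 (k%:R : R) q) (gap0 k.+1 (leqW k2)).
    suff : k%:R `^ q * gap dot c p x xbar F m k.+1
      + k%:R `^ q * dot (vel x k.+1) (vel x k.+1)
      + k%:R `^ (2 * q) * dot (u k.+1) (u k.+1) <= T k - T k.+1 by lra.
    by near: k.
  (* The summand of index k+1 is the velocity of index k+2, so the potential is shifted by one. *)
  - apply: (@nneseries_telescope_lty _ _ _ (fun k => T k.+1)).
    + by move=> k _; rewrite mulr_ge0 ?powR_ge0.
    + exact: near_succ T0.
    have TS' := near_succ TS; near=> k; have k2 : (2 <= k)%N by near: k.
    rewrite (normr_dot norm_dot) -/(vel x k.+2).
    have := mulr_ge0 (powR_ge0 (k.+1%:R : R) (2 * q)) (dot_ge0 dot (u k.+2)).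
    have := mulr_ge0 (powR_ge0 (k.+1%:R : R) q) (gap0 k.+2 (leqW (leqW k2))).
    suff : k.+1%:R `^ q * gap dot c p x xbar F m k.+2
      + k.+1%:R `^ q * dot (vel x k.+2) (vel x k.+2)
      + k.+1%:R `^ (2 * q) * dot (u k.+2) (u k.+2) <= T k.+1 - T k.+2 by lra.
    by near: k; exact: TS'.
split.
- move=> p2q.
  (* Damping limits the dissipation, rho = q, and the Tikhonov variation dominates the source; the
     error exponent is p - tau = q - 1, through strong convexity. *)
  have [|||||||||[E1 E2] [_ E3 E4] E5] := conclude q (p + 1 - q) (q - 1);
    try by clear -q0 q1 p0 pq p2q; lra.
  rewrite (_ : q - p - 1 = - (p + 1 - q)); last by ring.
  by split => //; apply: E5; clear -q0 q1 p0 pq p2q; lra.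
- move=> /andP[q2p pq2].
  (* Now rho = p - q with the same dominant source; the error exponent is 2 q - tau = q - 1, through
     the energy. *)
  have [|||||||||E1 E2 E5] := conclude (p - q) (q + 1) (q - 1); try by clear -q0 q1 p0 pq q2p pq2; lra.
  rewrite (_ : - q - 1 = - (q + 1)); last by ring.
  by split => //; [apply: E5; clear -q0 q1 p0 pq q2p pq2; lra|exact: sum_lty].
- move=> /andP[q2p pq2].
  (* The motion of the path dominates: rho + tau = 3 q + 2 - p and the error exponent is 2 q - tau.
     The threshold (4 q + 2) / 3 for p is where tau = p. *)
  have [|||||||||E1 E2 E5] := conclude (p - q) (4 * q + 2 - 2 * p) (2 * p - 2 * q - 2);
    try by clear -q0 q1 p0 pq q2p pq2; lra.
  rewrite (_ : 2 * p - 4 * q - 2 = - (4 * q + 2 - 2 * p)); last by ring.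
  rewrite (_ : p - q - 1 = (2 * p - 2 * q - 2) / 2); last by field.
  split => //.
  + by move=> h; apply: E5; clear -q0 q1 p0 pq q2p pq2 h; lra.
  + by move=> h; apply: E5; clear -q0 q1 p0 pq q2p pq2 h; lra.
  + by apply: sum_lty; clear -q0 q1 p0 pq q2p pq2; lra.
Unshelve. all: by end_near. Qed.
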